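(* Let $P$ be a finite $(2+1)$-free poset with $n$ elements and let $\lambda\vdash n$. Then the coefficient $[s_\lambda]L_P$ of the Schur function $s_\lambda$ in the Schur expansion of $L_P$ is the number of $P$-tableaux of shape $\lambda$.
   Context: A poset is $(2+1)$-free if it contains no induced subposet isomorphic to the disjoint union of a $2$-element chain and a $1$-element chain. A linear extension of a finite poset $Q$ is a list $(\omega_1,\dots,\omega_m)$ of all elements of $Q$ without repetition with no $i<j$ such that $\omega_j\le_Q\omega_i$; $\zeta(Q)$ is the number of linear extensions of $Q$. The diagram of a partition $\lambda=(\lambda_1,\dots,\lambda_k)$ is the left-justified array of cells with $\lambda_i$ cells in row $i$ (rows numbered from the top). For a poset $P$ with $n$ elements and $\lambda\vdash n$, a $P$-tableau of shape $\lambda$ is a filling $(a_{i,j})$ of the diagram of $\lambda$ with the elements of $P$, each used exactly once, such that every row, read left to right, is a linear extension of the induced subposet of $P$ on its entries, and the columns are strictly increasing, i.e. whenever $a_{i+1,j}$ is defined, $a_{i,j}$ is also defined and $a_{i,j}<_Pa_{i+1,j}$. The linear function of $P$ is $L_P=\sum\zeta(P_1)\cdots\zeta(P_k)M_{(|P_1|,\dots,|P_k|)}$, the sum being over all set compositions (ordered set partitions into nonempty blocks) $(P_1,\dots,P_k)$ of $P$, each block with the induced order, where $M_\alpha=\sum_{i_1<\cdots<i_k}x_{i_1}^{\alpha_1}\cdots x_{i_k}^{\alpha_k}$. It is the image of $P$ under the canonical morphism to $QSym$ from the cocommutative Hopf algebra of posets (product: ordinal sum; coproduct: $P\mapsto\sum_S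 P|_S\otimes P|_{P\setminus S}$) with character $\zeta$, and it is a symmetric function; coefficients are in a field of characteristic $0$. The Schur functions are $s_\lambda=\det(h_{\lambda_i-i+j})_{i,j=1}^k$, with $h_r$ the complete homogeneous symmetric functions. *)

(* Defs.v *)
From HB Require Import structures.
From mathcomp Require Export all_boot all_order all_algebra.
From mathcomp Require Export finmap.
From mathcomp Require Export mpoly.

Set Implicit Arguments.
Unset Strict Implicit.
Unset Printing Implicit Defensive.

Import Order.TTheory GRing.Theory.

Local Open Scope ring_scope.

Section Posets.

Variables (d : Order.disp_t) (P : finPOrderType d).

(* Elements incomparable to a are distinct from a, so {a, b, c} is an induced
   copy of the 3-element poset consisting of the chain a < b and the isolated
   point c. *)
Definition two_plus_one_free : Prop :=
  forall a b c : P, ~ [/\ (a < b)%O, (a >< c)%O & (b >< c)%O].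

Definition linear_extension (Q : {set P}) (w : seq P) : bool :=
  [&& uniq w, [forall x, (x \in w) == (x \in Q)]
    & pairwise (fun x y => ~~ (y <= x)%O) w].

Definition zeta (Q : {set P}) : nat :=
  #|[set w : #|Q|.-tuple P | linear_extension Q w]|.

Definition set_composition (C : seq {set P}) : bool :=
  [&& set0 \notin C, pairwise (fun A B : {set P} => [disjoint A & B]) C
    & \bigcup_(A <- C) A == [set: P]].

End Posets.

Definition is_partition (s : seq nat) : bool := sorted geq s && (0%N \notin s).

Record intpart : Type := IntPart {
  parts : seq nat;
  _ : is_partition parts
}.
HB.instance Definition _ := [isSub for parts].
HB.instance Definition _ := [Choice of intpart by <:].

(* The cells (i, j) of the diagram, rows and columns being numbered from 0. *)
Definition cell (lam : intpart) : finType :=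
  {i : 'I_(size (parts lam)) & 'I_(nth 0%N (parts lam) i)}.

Definition cell_row (lam : intpart) (c : cell lam) : nat := tag c.
Definition cell_col (lam : intpart) (c : cell lam) : nat := tagged c.

Section Tableaux.

Variables (d : Order.disp_t) (P : finPOrderType d) (lam : intpart).

Definition row_word (a : {ffun cell lam -> P}) (i : 'I_(size (parts lam))) :
    seq P :=
  [seq a (Tagged (fun i : 'I_(size (parts lam)) => 'I_(nth 0%N (parts lam) i)) j)
     | j <- enum 'I_(nth 0%N (parts lam) i)].

(* As lam is weakly decreasing, a cell always lies above each cell outside the
   first row, so the column condition only has to compare entries. *)
Definition P_tableau (a : {ffun cell lam -> P}) : bool :=
  [&& [forall x : P, #|[set c | a c == x]| == 1%N],
      [forall i, linear_extension [set x in row_word a i] (row_word a i)]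
    & [forall c, forall c',
        (cell_row c' == (cell_row c).+1) && (cell_col c' == cell_col c)
          ==> (a c < a c')%O]].

End Tableaux.

Section SymmetricFunctions.

Variable F : fieldType.

(* An element of the ring of formal power series of bounded degree in
   x_1, x_2, ... is represented by the family of its truncations to the first
   N variables (x_i = 0 for i > N), for all N. *)
Definition symfun : Type := forall N : nat, {mpoly F[N]}.

Definition monomial_qsym (alpha : seq nat) : symfun := fun N =>
  \sum_(i : (size alpha).-tuple 'I_N | sorted ltn [seq val l | l <- i])
     \prod_(j < size alpha) 'X_(tnth i j) ^+ nth 0%N alpha j.

(* A set composition of P has at most #|P| blocks. *)
Definition linear_function (d : Order.disp_t) (P : finPOrderType d) : symfun :=
  fun N =>
  \sum_(k < #|P|.+1) \sum_(C : k.-tuple {set P} | set_composition C)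
     (\prod_(A <- C) zeta A)%N%:R *: monomial_qsym [seq #|A| | A : {set P} <- C] N.

Definition complete_hom (r : int) : symfun := fun N =>
  match r with
  | Posz m => \sum_(mon : 'X_{1..N < m.+1} | mdeg mon == m) 'X_[mon]
  | Negz _ => 0
  end.

Definition schur (lam : intpart) : symfun := fun N =>
  \det (\matrix_(i < size (parts lam), j < size (parts lam))
          complete_hom ((nth 0%N (parts lam) i)%:Z - i%:Z + j%:Z) N).

Definition schur_expansion (f : symfun) (c : {fsfun intpart -> F with 0}) :
    Prop :=
  forall N, f N = \sum_(mu <- finsupp c) c mu *: schur mu N.

(* [s_lam] f = x, including that f has a Schur expansion at all. *)
Definition schur_coefficient (f : symfun) (lam : intpart) (x : F) : Prop :=
  (exists c, schur_expansion f c) /\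
  (forall c, schur_expansion f c -> c lam = x).

End SymmetricFunctions.

(* Main.v *)
(** Write an array as a family of N words, each a linear extension of its
    letters, covering P exactly once; then L_P in N variables is the sum of
    x^(row sizes) over all arrays. The coefficient of s_la in a symmetric function
    f is the coefficient of x^(la + delta) in a_delta f, where a_delta is the
    Vandermonde alternant: indeed a_delta s_mu = a_(mu + delta) by the
    Jacobi-Trudi factorization (and s_mu = 0 in fewer variables than parts), and
    an alternating polynomial in characteristic 0 is determined by its
    coefficients at strictly decreasing exponents. For f = L_P this coefficient
    is a signed sum over pairs of a permutation s and an array whose row i has
    la_(s i) - s i + i letters. As in Gasharov's proof for chromatic symmetric
    functions, these pairs cancel under a sign-reversing involution: take the
    leftmost column violating the column condition, the lowest violation in it,
    and swap the tails of the two rows there. The pairs left over have s = 1 and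
    are the P-tableaux of shape la. *)

Require Import Defs.
From mathcomp Require Import fingroup perm zify.

Set Implicit Arguments.
Unset Strict Implicit.
Unset Printing Implicit Defensive.

Import Order.TTheory GRing.Theory.
Local Open Scope ring_scope.

(** * Complete homogeneous polynomials in a subset of the variables *)

Section SymmetricPolynomials.

Variables (F : fieldType) (N : nat).
Implicit Types (S : {set 'I_N}) (m : 'X_{1..N}).

(** The set [S] selects variables inside one fixed ring, so that variables can be removed one at a
    time without changing the type. *)
Definition hom_in S (r : int) : {mpoly F[N]} :=
  match r with
  | Posz k => \sum_(mon : 'X_{1..N < k.+1} |
                (mdeg mon == k) && [forall i, (i \in S) || (mon i == 0%N)]) 'X_[mon]
  | Negz _ => 0
  end.

Lemma mcoeff_hom_in S (r : int) m :
  (hom_in S r)@_m =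
  ((Posz (mdeg m) == r) && [forall i, (i \in S) || (m i == 0%N)])%:R.
Proof.
case: r => [k|k] /=; last by rewrite mcoeff0.
rewrite raddf_sum /= eqz_nat.
under eq_bigr => mon _ do rewrite mcoeffX.
case: andP => [[dm mS]|nm].
  have lt_m : (mdeg m < k.+1)%N by rewrite (eqP dm).
  rewrite (bigD1 (BMultinom lt_m)) /= ?eqxx ?dm // big1 ?addr0 // => mon /andP[_].
  by rewrite -val_eqE /= => /negbTE ->.
rewrite big1 // => mon Hmon; case: eqP => // e; case: nm.
by move: Hmon; rewrite e => /andP[].
Qed.

Lemma complete_homE (r : int) : complete_hom F r N = hom_in setT r.
Proof.
case: r => [k|k] //=; apply: eq_bigl => mon.
suff -> : [forall i, (i \in [set: 'I_N]) || (mon i == 0%N)] by rewrite andbT.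
by apply/forallP => i; rewrite inE.
Qed.

(** A monomial of degree [r] in the variables of [S] either avoids ['X_k] or is ['X_k] times such a
    monomial of degree [r - 1]. *)
Lemma hom_in_recl S k (r : int) : k \in S ->
  hom_in S r - 'X_k * hom_in S (r - 1) = hom_in (S :\ k) r.
Proof.
move=> kS; apply/mpolyP => m; rewrite mcoeffB !mcoeff_hom_in mulrC.
have [m0|m0] := posnP (m k).
  rewrite [X in _ - X](_ : _ = 0) ?subr0.
    congr (_ && _)%:R; apply: eq_forallb => i; rewrite !inE.
    by case: (i =P k) => //= ->; rewrite m0 eqxx kS.
  apply/eqP; rewrite mcoeff_eq0; apply/negP => /msuppM_le.
  case/allpairsP => -[m1 m2] /= [_]; rewrite msuppX inE => /eqP -> e.
  by move: m0; rewrite e mnmDE mnm1E eqxx addn1.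
have em : m = (U_(k) + (m - U_(k)))%MM.
  apply/mnmP => i; rewrite mnmDE mnmBE mnm1E; case: eqP => [<-|_] /=; last by rewrite add0n subn0.
  by rewrite add1n subn1 prednK.
rewrite [X in _@_X]em mcoeffMX mcoeff_hom_in.
rewrite [X in _ = (nat_of_bool X)%:R](_ : _ = false); last first.
  apply/negP => /andP[_ /forallP/(_ k)]; rewrite !inE eqxx /=.
  by rewrite (gtn_eqF m0).
apply/eqP; rewrite subr_eq0; apply/eqP; congr (_ && _)%:R.
  have -> : mdeg m = (mdeg (m - U_(k))).+1 by rewrite {1}em mdegD mdeg1.
  by apply/eqP/eqP; lia.
apply: eq_forallb => i; rewrite mnmBE mnm1E.
by case: (k =P i) => [<-|_]; rewrite ?kS // subn0.
Qed.

Lemma hom_in0 (r : int) : hom_in set0 r = (r == 0)%:R.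
Proof.
apply/mpolyP => m; rewrite mcoeff_hom_in.
have -> : [forall i, (i \in set0) || (m i == 0%N)] = (m == 0%MM).
  apply/forallP/eqP => [H|-> i]; last by rewrite mnm0E eqxx orbT.
  by apply/mnmP => i; rewrite mnm0E; move: (H i); rewrite inE => /eqP.
have -> : ((r == 0)%:R : {mpoly F[N]}) = (r == 0)%:R%:MP by rewrite rmorph_nat.
rewrite mcoeffC; case: (m =P 0%MM) => [->|_]; last by rewrite andbF mulr0.
by rewrite mdeg0 andbT mulr1 eq_sym.
Qed.

Lemma hom_in1 k (r : nat) : hom_in [set k] r = 'X_k ^+ r.
Proof.
have rec (q : int) : hom_in [set k] q = (q == 0)%:R + 'X_k * hom_in [set k] (q - 1).
  have := @hom_in_recl [set k] k q (set11 k).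
  by rewrite setDv hom_in0 => <-; rewrite subrK.
elim: r => [|r IH]; rewrite rec; first by rewrite /= mulr0 addr0 expr0.
have -> : r.+1%:Z - 1 = r%:Z by lia.
by rewrite add0r IH exprS.
Qed.

(* The action of the power series ring R[[T]] on functions int -> R, T acting
   as the shift; the truncation at K is harmless once [size q <= K]. *)
Definition shift_act (K : nat) (q : {poly {mpoly F[N]}}) (g : int -> {mpoly F[N]})
  (a : int) : {mpoly F[N]} := \sum_(i < K) q`_i * g (a - i%:Z).

Lemma shift_act_widen K K' (q : {poly {mpoly F[N]}}) g a : (size q <= K)%N -> (K <= K')%N ->
  shift_act K' q g a = shift_act K q g a.
Proof.
move=> sq le; rewrite /shift_act (big_ord_widen K' (fun i => q`_i * g (a - i%:Z)) le).
rewrite [RHS]big_mkcond; apply: eq_bigr => i _; case: ltnP => // h.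
by rewrite nth_default ?mul0r // (leq_trans sq).
Qed.

(** The factor 1 - xT commutes with [q], so it may act on [g] first; it raises the degree by one,
    hence the bound [K.+1]. *)
Lemma shift_actM1 K (x : {mpoly F[N]}) (q : {poly {mpoly F[N]}}) g a : (size q <= K)%N ->
  shift_act K.+1 ((1 - x *: 'X) * q) g a =
  shift_act K q (fun b => g b - x * g (b - 1)) a.
Proof.
move=> sq; rewrite -[RHS](@shift_act_widen _ K.+1) // /shift_act.
under [RHS]eq_bigr => i _ do rewrite mulrBr.
rewrite sumrB.
under eq_bigr => i _ do
  rewrite mulrBl mul1r coefB -scalerAl coefZ coefXM mulrBl.
rewrite sumrB; congr (_ - _).
rewrite big_ord_recl [RHS]big_ord_recr /= mulr0 mul0r add0r.
rewrite nth_default // mul0r addr0; apply: eq_bigr => i _ /=.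
rewrite /bump /= mulrCA mulrA; congr (_ * g _); lia.
Qed.

(** The reciprocal of the generating series of the complete homogeneous polynomials in the variables
    listed in [s]. *)
Definition rev_roots (s : seq 'I_N) : {poly {mpoly F[N]}} :=
  \prod_(l <- s) (1 - 'X_l *: 'X).

Lemma size_rev_roots s : (size (rev_roots s) <= (size s).+1)%N.
Proof.
rewrite /rev_roots; elim: s => [|l s IH]; first by rewrite big_nil size_poly1.
rewrite big_cons /=; apply: leq_trans (size_polyMleq _ _) _.
have : (size (1 - 'X_l *: 'X : {poly {mpoly F[N]}})%R <= 2)%N.
  apply: leq_trans (size_polyD _ _) _.
  by rewrite geq_max size_poly1 size_polyN (leq_trans (size_scale_leq _ _)) ?size_polyX.
by move=> h; rewrite -subn1 leq_subLR; apply: leq_trans (leq_add h IH) _.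
Qed.

(** By [hom_in_recl], each factor 1 - x_l T removes the variable x_l from [S]. *)
Lemma shift_act_rev_roots K s S a : uniq s -> {subset s <= S} ->
  (size s < K)%N ->
  shift_act K (rev_roots s) (hom_in S) a = hom_in (S :\: [set l in s]) a.
Proof.
elim: s K S a => [|l s IH] K S a.
  move=> _ _ K0; rewrite (@shift_act_widen 1) ?size_rev_roots //.
  rewrite /shift_act big_ord1 /rev_roots big_nil coef1 mul1r subr0.
  by congr hom_in; apply/setP => i; rewrite !inE.
case: K => // K /= /andP[ls us] sS sK.
rewrite /rev_roots big_cons shift_actM1; last first.
  by apply: leq_trans (size_rev_roots s) _.
have lS : l \in S by apply: sS; rewrite inE eqxx.
transitivity (shift_act K (rev_roots s) (hom_in (S :\ l)) a).
  by apply: eq_bigr => i _; rewrite hom_in_recl.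
rewrite IH //.
  by congr hom_in; apply/setP => i; rewrite !inE; case: (i == l); case: (i \in s).
move=> i si; rewrite !inE sS ?inE ?si ?orbT // andbT.
by apply: contraNneq ls => <-.
Qed.

Lemma hom_in_lt0 S (r : int) : r < 0 -> hom_in S r = 0.
Proof. by case: r. Qed.

(** * Jacobi-Trudi determinants and alternants *)

Definition jacobi_trudi (k : nat) (mu : nat -> nat) : {mpoly F[N]} :=
  \det (\matrix_(i < k, j < k) hom_in setT ((mu i)%:Z - i%:Z + j%:Z)).

Lemma schurE (mu : intpart) :
  schur F mu N = jacobi_trudi (size (parts mu)) (nth 0%N (parts mu)).
Proof. by congr (\det _); apply/matrixP => i j; rewrite !mxE complete_homE. Qed.

(** The last row is (0, ..., 0, 1), its other entries having negative degree. This allows padding a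
    partition by zero parts. *)
Lemma jacobi_trudiS k mu : mu k = 0%N -> jacobi_trudi k.+1 mu = jacobi_trudi k mu.
Proof.
move=> muk; rewrite /jacobi_trudi (expand_det_row _ ord_max) big_ord_recr /=.
rewrite big1 ?add0r => [|j _].
  rewrite mxE /= muk sub0r addNr.
  have -> : hom_in setT 0 = 1 :> {mpoly F[N]}.
    apply/mpolyP => m; rewrite mcoeff_hom_in mcoeff1 -mdeg_eq0 eqz_nat.
    suff -> : [forall i, (i \in [set: 'I_N]) || (m i == 0%N)] by rewrite andbT.
    by apply/forallP => i; rewrite inE.
  rewrite mul1r /cofactor -signr_odd addnn odd_double mul1r.
  by congr (\det _); apply/matrixP => i j; rewrite !mxE !lift_max.
rewrite mxE /= muk sub0r.
have jk := ltn_ord j; rewrite hom_in_lt0 ?mul0r //; lia.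
Qed.

Lemma jacobi_trudi_widen k l mu : (k <= l)%N ->
  (forall i, (k <= i)%N -> mu i = 0%N) -> jacobi_trudi l mu = jacobi_trudi k mu.
Proof.
move=> /subnK <- mu0; elim: (l - k)%N => // n IH.
by rewrite addSn jacobi_trudiS // mu0 // leq_addl.
Qed.

Definition alternant (alpha : 'I_N -> nat) : {mpoly F[N]} :=
  \det (\matrix_(i, j) 'X_j ^+ alpha i).

(** This is mu + delta with delta = (N - 1, ..., 1, 0). *)
Definition delta_shift (mu : nat -> nat) (i : 'I_N) : nat := (mu i + (N - i.+1))%N.

(** Removing every variable except x_k turns h_a into x_k^a, which writes each entry of the
    alternant as a combination of complete homogeneous polynomials in all variables. The
    coefficients do not depend on [mu] or on the row, so the matrix is a product. *)
Lemma alternant_factor mu :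
  alternant (delta_shift mu) =
  jacobi_trudi N mu *
  \det (\matrix_(j < N, k < N) (rev_roots (rem k (enum 'I_N)))`_(N - j.+1)).
Proof.
rewrite -det_mulmx; congr (\det _); apply/matrixP => i k; rewrite !mxE.
have uE := enum_uniq 'I_N; have sE := size_enum_ord N.
transitivity (shift_act N (rev_roots (rem k (enum 'I_N))) (hom_in setT)
  (delta_shift mu i)).
  have srem : (size (rem k (enum 'I_N)) < N)%N.
    by rewrite size_rem ?mem_enum // sE prednK // (leq_trans _ (ltn_ord k)).
  rewrite shift_act_rev_roots ?rem_uniq //; last by move=> l; rewrite inE.
  rewrite -hom_in1; congr hom_in; apply/setP => l.
  rewrite !inE mem_rem_uniq // !inE mem_enum; by case: (l == k).
(* Reversing the sum turns the degree (mu_i + N - 1 - i) - j into the Jacobi-Trudi degree mu_i - i +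
   j. *)
rewrite /shift_act (reindex_inj rev_ord_inj); apply: eq_bigr => j _.
rewrite !mxE mulrC; congr (hom_in _ _ * _).
rewrite /delta_shift /=; have := ltn_ord i; have := ltn_ord j; lia.
Qed.

Lemma jacobi_trudi_nil k : jacobi_trudi k (fun=> 0%N) = 1.
Proof. by rewrite (@jacobi_trudi_widen 0) // /jacobi_trudi det_mx00. Qed.

(** Removing all N variables from h_r leaves 0 when r > 0; this is a linear relation between the
    columns of the matrix. *)
Lemma jacobi_trudi_eq0 l mu : (N < l)%N -> (forall i, (i < l)%N -> (0 < mu i)%N) ->
  jacobi_trudi l mu = 0.
Proof.
case: l => // l; rewrite ltnS => Nl mu0.
rewrite /jacobi_trudi; set A := (X in \det X).
(* These are the coefficients of the product over all variables, in reverse order; its degree is at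
   most N, so none is cut off. *)
pose v : 'cV[{mpoly F[N]}]_l.+1 := \col_j (rev_roots (enum 'I_N))`_(l - j).
have Av : A *m v = 0.
  apply/matrixP => i o; rewrite !mxE.
  transitivity (shift_act l.+1 (rev_roots (enum 'I_N)) (hom_in setT)
    ((mu i)%:Z - i%:Z + l%:Z)).
    rewrite /shift_act (reindex_inj rev_ord_inj); apply: eq_bigr => j _.
    have jl := ltn_ord j; rewrite !mxE mulrC; congr (_`__ * hom_in _ _); rewrite /=; lia.
  rewrite shift_act_rev_roots ?enum_uniq ?size_enum_ord //; last first.
    by move=> x; rewrite inE.
  rewrite (_ : _ :\: _ = set0) ?hom_in0; last first.
    by apply/setP => x; rewrite !inE mem_enum.
  by have := mu0 i (ltn_ord i); have := ltn_ord i; case: eqP => //; lia.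
(* Multiplication by the adjugate kills det A times [v], and the last entry of [v] is the constant
   term 1 of the product. *)
have /matrixP/(_ ord_max 0) : \det A *: v = 0.
  by rewrite -mul_scalar_mx -mul_adj_mx -mulmxA Av mulmx0.
rewrite !mxE /= subnn -horner_coef0 /rev_roots horner_prod.
rewrite big1 ?mulr1 // => j _.
by rewrite !hornerE subr0.
Qed.

(** The second factor in [alternant_factor] is the same for all [mu]; the zero partition, whose
    Jacobi-Trudi determinant is 1, identifies it as a_delta. *)
Lemma alternant_mul_schur (mu : intpart) :
  alternant (delta_shift (fun=> 0%N)) * schur F mu N =
  if (size (parts mu) <= N)%N then alternant (delta_shift (nth 0%N (parts mu)))
  else 0.
Proof.
rewrite schurE; case: leqP => [le|lt].
  rewrite -(jacobi_trudi_widen le); last by move=> i; exact: nth_default.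
  by rewrite !alternant_factor jacobi_trudi_nil mul1r mulrC.
rewrite jacobi_trudi_eq0 ?mulr0 // => i lti; rewrite lt0n.
case: mu lt lti => mu /= /andP[_ mu0] _ lti.
by apply: contraNneq mu0 => <-; apply: mem_nth.
Qed.

(** * Coefficients of alternating polynomials at strictly decreasing exponents *)

Definition decreasing_exp (a : 'I_N -> nat) := forall i j : 'I_N, (i < j)%N -> (a j < a i)%N.

(** An increasing permutation satisfies i <= s i; the same bound for the inverse forces equality. *)
Lemma increasing_perm1 (s : 'S_N) :
  (forall i j : 'I_N, (i < j)%N -> (s i < s j)%N) -> s = 1%g.
Proof.
have ge_id (t : 'S_N) (H : forall i j : 'I_N, (i < j)%N -> (t i < t j)%N) :
    forall i : 'I_N, (i <= t i)%N.
  case=> i lti /=; elim: i lti => // i IH lti.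
  have lti' := ltnW lti.
  by apply: leq_ltn_trans (IH lti') _; apply: H.
move=> inc; have incV (i j : 'I_N) : (i < j)%N -> (s^-1%g i < s^-1%g j)%N.
  apply: contraTT; rewrite -!leqNgt leq_eqVlt => /orP[/eqP/val_inj/perm_inj->//|].
  by move/inc; rewrite !permKV => /ltnW.
apply/permP => i; apply/val_inj/eqP; rewrite perm1 eqn_leq ge_id // andbT.
by have := ge_id _ incV (s i); rewrite permK.
Qed.

Lemma decreasing_exp_perm1 (a b : 'I_N -> nat) (s : 'S_N) :
  decreasing_exp a -> decreasing_exp b -> (forall i, a i = b (s i)) -> s = 1%g.
Proof.
move=> da db ab; apply: increasing_perm1 => i j /da; rewrite !ab.
apply: contraTT; rewrite -!leqNgt leq_eqVlt => /orP[/eqP/val_inj->//|].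
by move/db/ltnW.
Qed.

Lemma alternantE a :
  alternant a = \sum_(s : 'S_N) (-1) ^+ s *: 'X_[[multinom a (s^-1%g i) | i < N]].
Proof.
apply: eq_bigr => s _; rewrite mulr_sign scaler_sign (mpolyXE _ s).
by under eq_bigr => i _ do rewrite mxE; under [in RHS]eq_bigr => i _ do rewrite mnmE permK.
Qed.

(** No nontrivial rearrangement of a strictly decreasing exponent is strictly decreasing, so only
    the identity term can contribute. *)
Lemma mcoeff_alternant a (m : 'X_{1..N}) :
  decreasing_exp a -> decreasing_exp m ->
  (alternant a)@_m = [forall i, a i == m i]%:R.
Proof.
move=> da dm; rewrite alternantE raddf_sum /= (bigD1 (1%g : 'S_N)) //= big1 => [|s s1].
  rewrite odd_perm1 expr0 scale1r mcoeffX addr0; congr (nat_of_bool _)%:R.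
  apply/eqP/forallP => [<- i|H]; first by rewrite mnmE invg1 perm1.
  by apply/mnmP => i; rewrite mnmE invg1 perm1 (eqP (H i)).
rewrite mcoeffZ mcoeffX; case: eqP => [e|_]; last by rewrite mulr0.
case/eqP: s1; apply: (decreasing_exp_perm1 da dm) => i.
by rewrite -e mnmE permK.
Qed.

Lemma msym_alternant (s : 'S_N) a : msym s (alternant a) = (-1) ^+ s *: alternant a.
Proof.
rewrite !alternantE raddf_sum scaler_sumr [RHS](reindex_inj (mulIg s)).
apply: eq_bigr => /= t _; rewrite scalerA odd_permM -signr_addb addbC addbK msymZ msymX; congr (_ *: 'X_[_]).
by apply/mnmP => i; rewrite !mnmE invMg permM.
Qed.

Lemma sort_exponents (m : 'X_{1..N}) :
  (forall i j, m i = m j -> i = j) -> exists s : 'S_N, decreasing_exp (fun i => m (s i)).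
Proof.
move=> minj; pose r := fun i j : 'I_N => (m j <= m i)%N.
have rt : total r by move=> i j; exact: leq_total.
have rtr : transitive r by move=> j i k ji kj; exact: leq_trans kj ji.
have [s es] := @tuple_permP _ _ (sort r (enum 'I_N)) (ord_tuple N)
  (permEl (perm_sort r (enum 'I_N))).
exists s => i j ij.
have : pairwise r (sort r (enum 'I_N)) by rewrite -sorted_pairwise // sort_sorted.
rewrite {}es => /(pairwiseP i)/(_ i j); rewrite !inE size_tuple.
move=> /(_ (ltn_ord i) (ltn_ord j) ij).
rewrite -!tnth_nth !tnth_mktuple !tnth_ord_tuple /r leq_eqVlt.
by case/orP => // /eqP/minj/perm_inj ji; move: ij; rewrite ji ltnn.
Qed.

(** An exponent with distinct entries can be sorted at the cost of a sign. One with a repeated entry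
    is fixed by a transposition, so its coefficient equals its own negative and vanishes in
    characteristic 0. *)
Lemma antisymmetric_eq0 (g : {mpoly F[N]}) : [pchar F] =i pred0 ->
  (forall s : 'S_N, msym s g = (-1) ^+ s *: g) ->
  (forall m : 'X_{1..N}, decreasing_exp m -> g@_m = 0) -> g = 0.
Proof.
move=> charF ganti g0; apply/mpolyP => m; rewrite mcoeff0.
have gs (s : 'S_N) : g@_[multinom [tuple m (s i) | i < N]] = (-1) ^+ s * g@_m.
  by rewrite -mcoeff_sym ganti mcoeffZ.
have [/forallP minj|] := boolP [forall i, forall j, (m i == m j) ==> (i == j)].
  have [i j /eqP|s ds] := @sort_exponents m.
    by move=> e; apply/eqP; move/forallP: (minj i) => /(_ j)/implyP; apply.
  have dm : decreasing_exp [multinom [tuple m (s i) | i < N]].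
    by move=> i j ij; rewrite !multinomE !tnth_mktuple ds.
  have := g0 _ dm; rewrite gs => /eqP; rewrite mulrI_eq0 ?signr_eq0 //; first by move/eqP.
  by apply/lregP; rewrite signr_eq0.
move=> /forallPn[i /forallPn[j]]; rewrite negb_imply => /andP[/eqP mij ij].
have := gs (tperm i j); rewrite odd_tperm ij expr1 mulN1r.
have -> : [multinom [tuple m (tperm i j k) | k < N]] = m.
  by apply/mnmP => k; rewrite multinomE tnth_mktuple; case: tpermP => // ->.
move/eqP; rewrite -addr_eq0 -mulr2n -mulr_natl mulf_eq0 => /orP[|/eqP //].
by move/pcharf0P: charF => ->.
Qed.

Lemma alternant_delta_neq0 : alternant (delta_shift (fun=> 0%N)) != 0.
Proof.
have dd : decreasing_exp (delta_shift (fun=> 0%N)).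
  by move=> i j ij; rewrite /delta_shift; have := ltn_ord j; lia.
pose m := [multinom delta_shift (fun=> 0%N) i | i < N].
have dm : decreasing_exp m by move=> i j ij; rewrite !mnmE dd.
apply/negP => /eqP/(congr1 (fun p => p@_m)); rewrite mcoeff_alternant // mcoeff0.
case: forallP => [_ /eqP|[] i]; first by rewrite oner_eq0.
by rewrite mnmE.
Qed.

End SymmetricPolynomials.

(** * Partitions and strictly decreasing exponents *)

Section Partitions.

Implicit Types (mu la : intpart).

Lemma nth_parts_le mu i j : (i <= j)%N -> (nth 0 (parts mu) j <= nth 0 (parts mu) i)%N.
Proof.
case: mu => mu /= /andP[smu _] ij; case: (ltnP j (size mu)) => [jmu|mj]; last first.
  by rewrite nth_default.
have gt : transitive geq by move=> x y z yx xz; exact: leq_trans xz yx.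
by apply: (sorted_leq_nth gt leqnn 0%N smu) => //; rewrite inE // (leq_ltn_trans ij).
Qed.

Lemma nth_parts_gt0 mu i : (0 < nth 0 (parts mu) i)%N = (i < size (parts mu))%N.
Proof.
case: (ltnP i (size _)) => [h|h]; last by rewrite nth_default.
case: mu h => mu /= /andP[_ mu0] h; rewrite lt0n.
by apply: contraNneq mu0 => <-; apply: mem_nth.
Qed.

Lemma decreasing_delta_shift N mu : decreasing_exp (@delta_shift N (nth 0%N (parts mu))).
Proof.
move=> i j ij; rewrite /delta_shift; have := nth_parts_le mu (ltnW ij).
have := ltn_ord j; lia.
Qed.

Lemma delta_shift_inj N mu la : (size (parts mu) <= N)%N -> (size (parts la) <= N)%N ->
  @delta_shift N (nth 0%N (parts mu)) =1 @delta_shift N (nth 0%N (parts la)) -> mu = la.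
Proof.
move=> sm sl e.
have en i : nth 0%N (parts mu) i = nth 0%N (parts la) i.
  case: (ltnP i N) => [iN|Ni]; last by rewrite !nth_default // ?(leq_trans sm) ?(leq_trans sl).
  by have := e (Ordinal iN); rewrite /delta_shift /=; lia.
apply: val_inj; apply: (@eq_from_nth _ 0%N) => //.
have h i : (i < size (parts mu))%N = (i < size (parts la))%N by rewrite -!nth_parts_gt0 en.
by apply/eqP; rewrite eqn_leq; apply/andP; split; rewrite leqNgt ?{1}h ?ltnn // -h ltnn.
Qed.

(** The zeros of a weakly decreasing sequence are trailing, and the default value 0 replaces them
    once they are removed. *)
Lemma nth_filter_gt0 (s : seq nat) i : sorted geq s ->
  nth 0%N [seq x <- s | (0 < x)%N] i = nth 0%N s i.
Proof.
elim: s i => //= x s IH i xs; have ss := path_sorted xs.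
have gt : transitive geq by move=> a b c ab bc; exact: leq_trans bc ab.
case: (posnP x) xs => [->|x0] xs; last by case: i => //= i; rewrite IH.
rewrite IH //; move: xs; rewrite (path_sortedE gt) => /andP[/allP s0 _].
have nz k : nth 0%N s k = 0%N.
  case: (ltnP k (size s)) => h; last by rewrite nth_default.
  by have := s0 _ (mem_nth 0%N h); rewrite /= leqn0 => /eqP.
by rewrite nz; case: i => //= i; rewrite nz.
Qed.

Lemma partition_of_exponents N (m : 'I_N -> nat) : decreasing_exp m ->
  exists2 mu : intpart, (size (parts mu) <= N)%N & m =1 delta_shift (nth 0%N (parts mu)).
Proof.
move=> dm.
(* The sequence drops by at least k over k places; comparison with the last place gives m_i >= N - 1
   - i, so delta can be subtracted. *)
have gap k (i j : 'I_N) : (j = i + k :> nat)%N -> (m j + k <= m i)%N.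
  elim: k i j => [|k IH] i j e; first by rewrite (_ : j = i) ?addn0 //; apply: val_inj; rewrite /= e addn0.
  have lt : (i.+1 < N)%N by have := ltn_ord j; lia.
  have h1 : (m j + k <= m (Ordinal lt))%N by apply: IH; rewrite e /=; lia.
  have h2 : (m (Ordinal lt) < m i)%N by apply: dm => /=.
  lia.
have ge (i : 'I_N) : (N - i.+1 <= m i)%N.
  have lt : (N.-1 < N)%N by have := ltn_ord i; lia.
  have := @gap (N - i.+1)%N i (Ordinal lt); have := ltn_ord i => /=; lia.
pose s := [seq (m i - (N - i.+1))%N | i <- enum 'I_N].
have sE : size s = N by rewrite size_map size_enum_ord.
have ns (i : 'I_N) : nth 0%N s i = (m i - (N - i.+1))%N.
  by rewrite (nth_map i) ?size_enum_ord // nth_ord_enum.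
have ss : sorted geq s.
  apply/(sortedP 0%N) => i; rewrite sE => lt.
  rewrite (ns (Ordinal lt)) (ns (Ordinal (ltnW lt))) /=.
  have := @gap 1%N (Ordinal (ltnW lt)) (Ordinal lt); rewrite /= addn1 => /(_ erefl).
  lia.
have ip : is_partition [seq x <- s | (0 < x)%N].
  rewrite /is_partition mem_filter ltnn /= andbT sorted_filter //.
  by move=> a b c ab bc; exact: leq_trans bc ab.
exists (IntPart ip) => [|i] /=.
  by rewrite size_filter -sE count_size.
by rewrite /delta_shift nth_filter_gt0 // ns subnK.
Qed.

End Partitions.

(** * Reading Schur coefficients off the product with a_delta *)

Section SchurCoefficient.

Variable F : fieldType.

Lemma mcoeff_alternant_mul_schur N (mu la : intpart) : (size (parts la) <= N)%N ->
  (alternant F (delta_shift (fun=> 0%N)) * schur F mu N)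
    @_[multinom delta_shift (nth 0%N (parts la)) i | i < N] = (mu == la)%:R.
Proof.
move=> sl; set m := [multinom _ | i < N].
have dm : decreasing_exp m.
  by move=> i j ij; rewrite !mnmE; apply: decreasing_delta_shift.
rewrite alternant_mul_schur; case: leqP => [sm|lt].
  rewrite mcoeff_alternant //; last exact: decreasing_delta_shift.
  congr (nat_of_bool _)%:R; apply/forallP/eqP => [H|-> i]; last by rewrite mnmE.
  by apply: (delta_shift_inj sm sl) => i; rewrite (eqP (H i)) mnmE.
by rewrite mcoeff0; case: eqP => // e; move: lt; rewrite e ltnNge sl.
Qed.

(** Since a_delta is nonzero in an integral domain, an expansion may be checked after multiplication
    by it. Both sides are then alternating, so only the coefficients at exponents mu + delta matter.
    The value [c0 mu] must be the same for all large enough [N]. *)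
Lemma schur_coefficientP (f : symfun F) (c0 : {fsfun intpart -> F with 0}) (la : intpart) :
  [pchar F] =i pred0 ->
  (forall N s, msym s (f N) = f N) ->
  (forall N (mu : intpart), (size (parts mu) <= N)%N ->
    (alternant F (delta_shift (fun=> 0%N)) * f N)
      @_[multinom delta_shift (nth 0%N (parts mu)) i | i < N] = c0 mu) ->
  schur_coefficient f la (c0 la).
Proof.
move=> charF fsym fc.
have cE N (c : {fsfun intpart -> F with 0}) (mu : intpart) : (size (parts mu) <= N)%N ->
    (alternant F (delta_shift (fun=> 0%N)) * (\sum_(nu <- finsupp c) c nu *: schur F nu N))
    @_[multinom delta_shift (nth 0%N (parts mu)) i | i < N] = c mu.
  move=> sm; rewrite mulr_sumr raddf_sum /=.
  under eq_bigr => nu _ do rewrite -scalerAr mcoeffZ mcoeff_alternant_mul_schur //.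
  have [muc|muc] := boolP (mu \in finsupp c).
    rewrite (big_fsetD1 mu) //= eqxx mulr1 big_seq big1 ?addr0 // => nu.
    by rewrite in_fsetD1 => /andP[/negbTE-> _]; rewrite mulr0.
  rewrite big_seq big1 ?fsfun_dflt // => nu nuc.
  by case: eqP => [e|]; rewrite ?mulr0 //; case/negP: muc; rewrite -e.
split; last first.
  (* Uniqueness is read off in as many variables as [la] has parts. *)
  move=> c fE; rewrite -(fc _ _ (leqnn (size (parts la)))) fE.
  by rewrite cE.
exists c0 => N; apply: (mulfI (alternant_delta_neq0 F N)); apply/eqP; rewrite -subr_eq0.
apply/eqP/antisymmetric_eq0 => // [s|m dm].
  rewrite msymB scalerBr; congr (_ - _); first by rewrite msymM fsym msym_alternant -scalerAl.
  rewrite mulr_sumr [msym s _]raddf_sum scaler_sumr; apply: eq_bigr => mu _.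
  rewrite /= -!scalerAr msymZ alternant_mul_schur.
  case: ifP => _; last by rewrite msym0 !scaler0.
  by rewrite msym_alternant scalerA mulrC -scalerA.
have [mu smu mE] := partition_of_exponents dm.
have -> : m = [multinom delta_shift (nth 0%N (parts mu)) i | i < N].
  by apply/mnmP => i; rewrite mnmE mE.
by rewrite mcoeffB fc // cE // subrr.
Qed.

End SchurCoefficient.

(** * The linear function as a sum over arrays *)

Section ArrayExpansion.

Variables (d : Order.disp_t) (P : finPOrderType d).

(* A row never exceeds #|P| entries, so bounded words keep the arrays finite. *)
Local Notation word := (#|P|.-bseq P).

Definition linear_word (w : seq P) : bool := pairwise (fun x y => ~~ (y <= x)%O) w.

Lemma linear_word_uniq w : linear_word w -> uniq w.
Proof. by apply: pairwise_uniq => x; rewrite lexx. Qed.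

Lemma linear_extensionE (Q : {set P}) w :
  linear_extension Q w = (Q == [set x in w]) && linear_word w.
Proof.
rewrite /linear_extension -/(linear_word w); case lw: (linear_word w); rewrite ?andbF //.
rewrite linear_word_uniq //= !andbT; apply/forallP/eqP => [H|-> x]; last by rewrite inE.
by apply/setP => x; rewrite inE (eqP (H x)).
Qed.

(** Words of bounded length form one index type for all [Q], as needed to expand a product of values
    of [zeta]. *)
Lemma zetaE (Q : {set P}) : zeta Q = (\sum_(w : word) linear_extension Q w)%N.
Proof.
pose g (w : #|Q|.-tuple P) : word := widen_bseq (max_card (mem Q)) w.
have ginj : injective g by move=> w1 w2 /(congr1 val) /= e; apply: val_inj.
rewrite /zeta -(card_imset _ ginj) -sum1_card big_mkcond /=.
apply: eq_bigr => w _.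
suff -> : (w \in [set g x | x in [set w : #|Q|.-tuple P | linear_extension Q w]]) = linear_extension Q w.
  by case: linear_extension.
apply/imsetP/idP => [[u]|lw]; first by rewrite inE => lu ->.
have sw : size w == #|Q|.
  move: lw; rewrite linear_extensionE => /andP[/eqP-> /linear_word_uniq uw].
  by rewrite cardsE (card_uniqP uw).
by exists (Tuple sw); [rewrite inE | apply: val_inj].
Qed.

Lemma zeta_set0 : zeta (set0 : {set P}) = 1%N.
Proof.
rewrite zetaE (bigD1 ([bseq] : word)) //= big1 => [|w wn].
  rewrite addn0 linear_extensionE /=; suff -> : set0 == [set x in [::]] :> {set P} by [].
  by apply/eqP/setP => x; rewrite !inE.
rewrite linear_extensionE; case: eqP => //= /setP e; apply/eqP; rewrite eqb0.
case/eqP: wn; apply: val_inj => /=; case: (bseqval w) e => // x s /(_ x).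
by rewrite !inE eqxx.
Qed.

(** Disjointness says that each point is covered at most once, the union condition that it is
    covered at least once. *)
Lemma set_compositionE (C : seq {set P}) :
  set_composition C = (set0 \notin C) && [forall x, count (fun A : {set P} => x \in A) C == 1%N].
Proof.
rewrite /set_composition; congr (_ && _).
have pw : pairwise (fun A B : {set P} => [disjoint A & B]) C =
          [forall x, (count (fun A : {set P} => x \in A) C <= 1)%N].
  elim: C => [|A C IH] /=; first by apply/esym/forallP => x.
  rewrite {}IH; apply/andP/forallP => [[/allP dA /forallP H] x|H].
    have [xA|xA] := boolP (x \in A); last exact: H.
    rewrite -[X in (_ <= X)%N]addn0 leq_add2l leqn0 eqn0Ngt -has_count.
    apply/hasPn => B BC; rewrite (disjointFr (dA _ BC)) //.
  split; last by apply/forallP => x; apply: leq_trans (leq_addl _ _) (H x).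
  apply/allP => B BC; rewrite -setI_eq0; apply/eqP/setP => x; rewrite !inE.
  apply/negP => /andP[xA xB]; have := H x; rewrite xA add1n ltnS leqn0 eqn0Ngt -has_count.
  by case/hasP; exists B.
have cv : (\bigcup_(A <- C) A == [set: P]) = [forall x, (0 < count (fun A : {set P} => x \in A) C)%N].
  apply/eqP/forallP => [/setP e x|H].
    by have := e x; rewrite inE -has_count bigcup_seq => /bigcupP[A AC xA]; apply/hasP; exists A.
  apply/setP => x; have := H x; rewrite inE -has_count => /hasP[A AC xA].
  by rewrite bigcup_seq; apply/bigcupP; exists A.
rewrite pw cv; apply/andP/forallP => [[/forallP H1 /forallP H2] x|H].
  by rewrite eqn_leq H1 H2.
by split; apply/forallP => x; rewrite (eqP (H x)).
Qed.

Variable N : nat.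

Definition weak_composition (W : {ffun 'I_N -> {set P}}) : bool :=
  [forall x, (\sum_i (x \in W i) == 1)%N].

Definition nonempty_blocks (W : {ffun 'I_N -> {set P}}) : {set 'I_N} :=
  [set i | W i != set0].

Lemma nonempty_blocksE W :
  #|nonempty_blocks W| = size [seq i <- enum 'I_N | W i != set0].
Proof.
rewrite size_filter -sum1_count big_enum_cond -sum1_card /=.
by apply: eq_bigl => i; rewrite inE.
Qed.

Lemma card_nonempty_blocks W : weak_composition W -> (#|nonempty_blocks W| <= #|P|)%N.
Proof.
move=> /forallP cW; rewrite -sum1dep_card -sum1_card.
(* Double counting of the pairs (i, x) with x in block i. *)
apply: (@leq_trans (\sum_i \sum_x (x \in W i))%N); last first.
  by rewrite exchange_big; apply: leq_sum => x _; rewrite (eqP (cW x)).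
rewrite big_mkcond; apply: leq_sum => i _; case: ifP => // /set0Pn[x xi].
by rewrite (bigD1 x) //= xi.
Qed.

(** Block j goes to the row named by entry j of [p.2]. For any other row [index] is out of range, so
    the default [set0] leaves it empty. *)
Definition spread k (p : k.-tuple {set P} * k.-tuple 'I_N) : {ffun 'I_N -> {set P}} :=
  [ffun i => nth set0 p.1 (index i p.2)].

Lemma spread_tnth k (p : k.-tuple {set P} * k.-tuple 'I_N) j : uniq p.2 ->
  spread p (tnth p.2 j) = tnth p.1 j.
Proof.
move=> u; rewrite ffunE (tnth_nth set0) (tnth_nth (tnth p.2 j)).
by rewrite index_uniq // size_tuple.
Qed.

Lemma spread_notin k (p : k.-tuple {set P} * k.-tuple 'I_N) i : i \notin val p.2 ->
  spread p i = set0.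
Proof.
move=> ni; rewrite ffunE nth_default // memNindex // !size_tuple //.
Qed.

Lemma big_spread (R : Type) (idx : R) (op : Monoid.com_law idx) k
    (p : k.-tuple {set P} * k.-tuple 'I_N) (G : 'I_N -> {set P} -> R) :
  uniq p.2 -> (forall i, G i set0 = idx) ->
  \big[op/idx]_i G i (spread p i) = \big[op/idx]_(j < k) G (tnth p.2 j) (tnth p.1 j).
Proof.
move=> u G0; rewrite (bigID (mem p.2)) /= [X in op _ X]big1 => [|i ni]; last first.
  by rewrite spread_notin.
rewrite Monoid.mulm1 -big_uniq // big_tnth.
pose e := size_tuple p.2.
rewrite (reindex (cast_ord (esym e))) /=; last first.
  by exists (cast_ord e) => j _; rewrite ?cast_ordK ?cast_ordKV.
apply: eq_bigr => j _.
have -> : tnth (in_tuple p.2) (cast_ord (esym e) j) = tnth p.2 j.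
  by rewrite [LHS](tnth_nth (tnth p.2 j)) [RHS](tnth_nth (tnth p.2 j)).
by rewrite spread_tnth.
Qed.

Definition composition_placement k (p : k.-tuple {set P} * k.-tuple 'I_N) : bool :=
  set_composition p.1 && sorted ltn [seq val l | l <- p.2].

Lemma sorted_val (s : seq 'I_N) :
  sorted ltn [seq val l | l <- s] = sorted (fun i j : 'I_N => (i < j)%N) s.
Proof. by rewrite sorted_map. Qed.

Lemma sorted_val_uniq (s : seq 'I_N) : sorted ltn [seq val l | l <- s] -> uniq s.
Proof. by move/(sorted_uniq ltn_trans ltnn); apply: map_uniq. Qed.

(** The blocks are nonempty, so the rows used are the support of the spread, and an increasing list
    is determined by its set of entries. *)
Lemma spread_inv k (p : k.-tuple {set P} * k.-tuple 'I_N) : composition_placement p ->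
  p.2 = [seq i <- enum 'I_N | spread p i != set0] :> seq 'I_N /\
  p.1 = [seq spread p i | i <- p.2] :> seq {set P}.
Proof.
case/andP; rewrite set_compositionE => /andP[n0 _] srt; have u := sorted_val_uniq srt.
split.
  apply: (@irr_sorted_eq _ (fun i j : 'I_N => (i < j)%N)).
  - by move=> x y z; exact: ltn_trans.
  - by move=> x; exact: ltnn.
  - by rewrite -sorted_val.
  - rewrite sorted_filter //; first by move=> x y z; exact: ltn_trans.
    by rewrite -sorted_val val_enum_ord iota_ltn_sorted.
  move=> i; rewrite mem_filter mem_enum andbT.
  have [/tnthP[j ->]|ni] := boolP (i \in val p.2); last by rewrite spread_notin ?eqxx.
  by rewrite spread_tnth //; apply/esym; apply: contraNneq n0 => <-; apply: mem_tnth.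
rewrite -[LHS]map_tnth_enum -[in RHS](map_tnth_enum p.2) -[RHS]map_comp.
by apply: eq_map => j /=; rewrite spread_tnth.
Qed.

Lemma weak_composition_spread k (p : k.-tuple {set P} * k.-tuple 'I_N) : uniq p.2 ->
  weak_composition (spread p) = [forall x, count (fun A : {set P} => x \in A) p.1 == 1%N].
Proof.
move=> u; apply: eq_forallb => x; congr (_ == _).
rewrite (@big_spread _ _ _ _ _ (fun _ A => nat_of_bool (x \in A))) //; last first.
  by move=> i; rewrite inE.
by rewrite -sum1_count [RHS]big_mkcond [RHS]big_tuple; apply: eq_bigr => j _; case: ifP.
Qed.

Lemma imset_spread k :
  @spread k @: [set p : k.-tuple {set P} * k.-tuple 'I_N | composition_placement p] =
  [set W | weak_composition W & #|nonempty_blocks W| == k].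
Proof.
apply/setP => W; rewrite !inE; apply/imsetP/andP => [[p + ->]|[cW /eqP kW]].
  rewrite inE => cp; have [e2 _] := spread_inv cp.
  have /andP[] := cp; rewrite set_compositionE => /andP[_ cnt] srt.
  rewrite weak_composition_spread ?sorted_val_uniq //; split => //.
  by rewrite -[X in _ == X](size_tuple p.2) e2 nonempty_blocksE.
pose I := [seq i <- enum 'I_N | W i != set0].
have sI : size I == k by rewrite -kW nonempty_blocksE.
pose p := (map_tuple W (Tuple sI), Tuple sI) : k.-tuple {set P} * k.-tuple 'I_N.
have uI : uniq p.2 by rewrite filter_uniq ?enum_uniq.
have WE : W = spread p.
  apply/ffunP => i; have [/tnthP[j ->]|ni] := boolP (i \in val p.2).
    by rewrite spread_tnth // tnth_map.
  by rewrite spread_notin //; move: ni; rewrite mem_filter mem_enum andbT negbK => /eqP.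
exists p => //; rewrite inE /composition_placement set_compositionE -andbA; apply/and3P; split.
- by apply/mapP => -[i]; rewrite mem_filter => /andP[/eqP ne _] e; apply: ne.
- by rewrite -weak_composition_spread // -WE.
rewrite sorted_val sorted_filter //.
  by move=> x y z; exact: ltn_trans.
by rewrite -sorted_val val_enum_ord iota_ltn_sorted.
Qed.

Lemma spread_inj k :
  {in [set p : k.-tuple {set P} * k.-tuple 'I_N | composition_placement p] &,
    injective (@spread k)}.
Proof.
move=> p q; rewrite !inE => /spread_inv[p2 p1] /spread_inv[q2 q1] e.
have e2 : p.2 = q.2 by apply: val_inj; rewrite /= p2 q2 e.
have e1 : p.1 = q.1 by apply: val_inj; rewrite /= p1 q1 e e2.
by rewrite (surjective_pairing p) (surjective_pairing q) e1 e2.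
Qed.


Variable F : fieldType.

Lemma monomial_qsym_tuple (alpha : seq nat) k : size alpha = k ->
  monomial_qsym F alpha N =
  \sum_(i : k.-tuple 'I_N | sorted ltn [seq val l | l <- i])
     \prod_(j < k) 'X_(tnth i j) ^+ nth 0%N alpha j.
Proof. by move=> e; case: k / e. Qed.

(** Weak compositions with k nonempty blocks correspond, via [spread], to a set composition with k
    blocks and a monomial of its [monomial_qsym]. Empty blocks contribute factors 1. *)
Lemma linear_function_weak :
  linear_function F P N = \sum_(W | weak_composition W)
    (\prod_i zeta (W i))%N%:R *: \prod_i 'X_i ^+ #|W i|.
Proof.
(* At most [#|P|] blocks are nonempty, so [inord] does not distort the count. *)
rewrite (partition_big (fun W => inord #|nonempty_blocks W| : 'I_#|P|.+1) xpredT) //=.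
apply: eq_bigr => k _.
transitivity (\sum_(W in [set W | weak_composition W & #|nonempty_blocks W| == k])
    (\prod_i zeta (W i))%N%:R *: \prod_i 'X_i ^+ #|W i| : {mpoly F[N]}); last first.
  apply: eq_bigl => W; rewrite inE; apply: andb_id2l => cW.
  by rewrite -val_eqE /= inordK // ltnS card_nonempty_blocks.
rewrite -imset_spread big_imset /=; last exact: spread_inj.
pose T (p : k.-tuple {set P} * k.-tuple 'I_N) : {mpoly F[N]} :=
  (\prod_(A <- p.1) zeta A)%N%:R *: \prod_(j < k) 'X_(tnth p.2 j) ^+ #|tnth p.1 j|.
transitivity (\sum_(C : k.-tuple {set P} | set_composition C)
    \sum_(i : k.-tuple 'I_N | sorted ltn [seq val l | l <- i]) T (C, i)).
  apply: eq_bigr => C _; rewrite (@monomial_qsym_tuple _ k) ?size_map ?size_tuple //.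
  rewrite scaler_sumr; apply: eq_bigr => i _; congr (_ *: _).
  apply: eq_bigr => j _.
  by rewrite (nth_map set0) ?size_tuple // -tnth_nth.
rewrite pair_big; apply: eq_big => [[C i]|[C i] /andP[_ srt]]; first by rewrite inE.
have u := sorted_val_uniq srt.
rewrite /T (@big_spread _ _ _ _ (C, i) (fun _ => @zeta d P)) //; last by move=> ?; exact: zeta_set0.
rewrite (@big_spread _ _ _ _ (C, i) (fun j A => 'X_j ^+ #|A|)) //; last first.
  by move=> j; rewrite cards0.
by rewrite /= big_tuple.
Qed.

Definition poset_array (t : {ffun 'I_N -> word}) : bool :=
  [forall x, (\sum_i (x \in (t i : seq P)) == 1)%N] && [forall i, linear_word (t i)].

Definition row_sizes (t : {ffun 'I_N -> word}) : 'X_{1..N} :=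
  [multinom size (t i) | i < N].

(** Expanding the products of [zeta] chooses a word for each row; the words determine the blocks as
    their sets of letters, so one weak composition survives for each array. *)
Lemma linear_function_arrays :
  linear_function F P N = \sum_(t | poset_array t) 'X_[row_sizes t].
Proof.
rewrite linear_function_weak.
under eq_bigr => W _.
  under eq_bigr => i _ do rewrite zetaE.
  rewrite bigA_distr_bigA natr_sum scaler_suml.
  over.
rewrite exchange_big /= [RHS]big_mkcond; apply: eq_bigr => t _.
pose W0 : {ffun 'I_N -> {set P}} := [ffun i => [set x in t i]].
have other W : W != W0 -> (\prod_i linear_extension (W i) (t i))%N = 0%N.
  move=> ne; have [i ni] : exists i, W i != W0 i.
    apply/existsP; apply: contraNT ne => /existsPn H; apply/eqP/ffunP => i.
    by have := H i; rewrite negbK => /eqP.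
  by rewrite (bigD1 i) //= linear_extensionE; move: ni; rewrite ffunE => /negbTE->.
have cW0 : weak_composition W0 = [forall x, (\sum_i (x \in (t i : seq P)) == 1)%N].
  apply: eq_forallb => x; congr (_ == _); apply: eq_bigr => i _.
  by rewrite ffunE inE.
rewrite big_mkcond (bigD1 W0) //= [X in _ + X]big1 ?addr0 => [|W ne]; last first.
  by rewrite other // scale0r if_same.
rewrite /poset_array -cW0; case: ifP => //= c0.
have -> : (\prod_i linear_extension (W0 i) (t i))%N = [forall i, linear_word (t i)].
  have [/forallP H|/forallPn[i Hi]] := boolP [forall i, linear_word (t i)].
    by rewrite big1 // => i _; rewrite linear_extensionE ffunE eqxx H.
  by rewrite (bigD1 i) //= linear_extensionE (negbTE Hi) andbF.
case: ifP => lw; last by rewrite scale0r.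
rewrite scale1r mpolyXE_id; apply: eq_bigr => i _; rewrite mnmE ffunE cardsE.
by rewrite (card_uniqP (linear_word_uniq (forallP lw i))).
Qed.

(** Permuting the variables amounts to permuting the rows of the arrays. *)
Lemma msym_linear_function (s : 'S_N) :
  msym s (linear_function F P N) = linear_function F P N.
Proof.
rewrite linear_function_arrays [msym s _]raddf_sum.
pose h (u : 'S_N) (t : {ffun 'I_N -> word}) := [ffun i => t (u i)] : {ffun 'I_N -> word}.
have hK : cancel (h s) (h s^-1%g).
  by move=> t; apply/ffunP => i; rewrite !ffunE permKV.
rewrite [LHS](reindex_inj (can_inj hK)); apply: eq_big => [t|t _].
  rewrite /poset_array; congr (_ && _).
    apply: eq_forallb => x; congr (_ == _); rewrite [RHS](reindex_inj (@perm_inj _ s)).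
    by apply: eq_bigr => i _; rewrite ffunE.
  apply/forallP/forallP => H i; last by rewrite ffunE.
  by have := H (s^-1%g i); rewrite ffunE permKV.
rewrite /= msymX; congr 'X_[_]; apply/mnmP => i; rewrite !mnmE.
by rewrite ffunE permKV.
Qed.

End ArrayExpansion.

(** * Swapping the tails of two rows *)

Section TailSwap.

Variables (d : Order.disp_t) (P : finPOrderType d).
Implicit Types (s : seq P) (c k : nat).

Lemma onth_take s c k : onth (take c s) k = if (k < c)%N then onth s k else None.
Proof.
elim: s c k => [|x s IH] [|c] [|k] //=; first by rewrite if_same.
by rewrite IH ltnS.
Qed.

Lemma onth_drop s c k : onth (drop c s) k = onth s (c + k).
Proof. by elim: s c => [|x s IH] [|c] //=; rewrite ?onth0n. Qed.

Lemma onth_size s k x : onth s k = Some x -> (k < size s)%N.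
Proof. by move=> e; rewrite -onthTE e. Qed.

Lemma linear_word_onth s i j x y : linear_word s -> (i < j)%N ->
  onth s i = Some x -> onth s j = Some y -> ~~ (y <= x)%O.
Proof.
move=> lw ij ei ej.
have := pairwiseP x lw i j; rewrite !inE (onth_size ei) (onth_size ej).
by rewrite (onth_nth x _ _ _ ei) (onth_nth x _ _ _ ej) => /(_ isT isT ij).
Qed.

Lemma linear_word_sub s1 s2 : subseq s1 s2 -> linear_word s2 -> linear_word s1.
Proof. exact: subseq_pairwise. Qed.

(** A missing upper entry above a present lower one is a violation, so the condition also controls
    the row lengths. *)
Definition col_ok s1 s2 c : bool :=
  if onth s2 c is Some y then (if onth s1 c is Some x then (x < y)%O else false)
  else true.

(** The cuts are offset by one: the upper row is cut before column c, the lower one after it. The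
    lengths (a, b) thus become (b - 1, a + 1), as when two adjacent entries of an exponent shifted
    by delta are exchanged. *)
Definition upper_swap s1 s2 c := take c s1 ++ drop c.+1 s2.
Definition lower_swap s1 s2 c := take c.+1 s2 ++ drop c s1.

Lemma col_ok_onth s1 s2 c y : col_ok s1 s2 c -> onth s2 c = Some y ->
  exists2 x, onth s1 c = Some x & (x < y)%O.
Proof. by rewrite /col_ok => + e; rewrite e; case: onth => // x xy; exists x. Qed.

Section Swap.

Variables (s1 s2 : seq P) (c : nat).
Hypotheses (lw1 : linear_word s1) (lw2 : linear_word s2).
Hypothesis ok_lt : forall k, (k < c)%N -> col_ok s1 s2 k.
Hypothesis flaw_c : ~~ col_ok s1 s2 c.

Lemma flaw_size2 : (c < size s2)%N.
Proof. by move: flaw_c; rewrite /col_ok -onthTE; case: onth. Qed.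

(** Column c - 1 is in order and the lower row reaches it, so the upper row does too; its entry in
    column c may be missing. *)
Lemma flaw_size1 : (c <= size s1)%N.
Proof.
case: (posnP c) => [->//|c0]; have lt : (c.-1 < c)%N by rewrite prednK.
have : onth s2 c.-1 by rewrite onthTE (leq_trans lt) // ltnW // flaw_size2.
case e : onth => [y|//] _; have [x ex _] := col_ok_onth (ok_lt lt) e.
by rewrite -(prednK c0) (onth_size ex).
Qed.

Let st1 : size (take c s1) = c.
Proof. by rewrite size_takel // flaw_size1. Qed.

Let st2 : size (take c.+1 s2) = c.+1.
Proof. by rewrite size_takel // flaw_size2. Qed.

Lemma size_upper_swap : (size (upper_swap s1 s2 c)).+1 = size s2.
Proof. rewrite size_cat st1 size_drop; have := flaw_size2; lia. Qed.

Lemma size_lower_swap : size (lower_swap s1 s2 c) = (size s1).+1.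
Proof. rewrite size_cat st2 size_drop; have := flaw_size1; lia. Qed.

Lemma perm_swap : perm_eq (upper_swap s1 s2 c ++ lower_swap s1 s2 c) (s1 ++ s2).
Proof.
rewrite -[X in perm_eq _ (X ++ _)](cat_take_drop c) -[X in perm_eq _ (_ ++ X)](cat_take_drop c.+1).
by apply/seq.permP => a; rewrite !count_cat; lia.
Qed.

Lemma upper_swapK : upper_swap (upper_swap s1 s2 c) (lower_swap s1 s2 c) c = s1.
Proof.
rewrite [LHS]/upper_swap take_size_cat // /lower_swap drop_size_cat //.
exact: cat_take_drop.
Qed.

Lemma lower_swapK : lower_swap (upper_swap s1 s2 c) (lower_swap s1 s2 c) c = s2.
Proof.
rewrite [LHS]/lower_swap take_size_cat // /upper_swap drop_size_cat //.
exact: cat_take_drop.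
Qed.

Lemma onth_upper_swap k : (k < c)%N -> onth (upper_swap s1 s2 c) k = onth s1 k.
Proof. by move=> kc; rewrite onth_cat st1 kc onth_take kc. Qed.

Lemma onth_lower_swap k : (k <= c)%N -> onth (lower_swap s1 s2 c) k = onth s2 k.
Proof. by move=> kc; rewrite onth_cat st2 ltnS kc onth_take ltnS kc. Qed.

Lemma onth_upper_swap_c : onth (upper_swap s1 s2 c) c = onth s2 c.+1.
Proof. by rewrite onth_cat st1 ltnn subnn onth_drop addn0. Qed.

(** Above s2[c] now stands s2[c+1], if anything; as it follows s2[c] in a linear word, it is not
    smaller. *)
Lemma flaw_swap : ~~ col_ok (upper_swap s1 s2 c) (lower_swap s1 s2 c) c.
Proof.
rewrite /col_ok onth_lower_swap // onth_upper_swap_c; move: flaw_size2.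
rewrite -onthTE; case e : (onth s2 c) => [y|//] _; case e' : onth => [x|//].
by apply: contraNN (linear_word_onth lw2 (ltnSn c) e e') => /ltW.
Qed.

(** A kept letter x = s1[k] lies below s2[k]. If a later letter y of [s2] were at most x, it would
    be at most s2[k], against the linearity of [s2]. *)
Lemma linear_upper_swap : linear_word (upper_swap s1 s2 c).
Proof.
rewrite /linear_word pairwise_cat; apply/and3P; split.
- apply/allrelP => x y /onthP[k]; rewrite onth_take; case: ltnP => // kc ek.
  case/onthP => l; rewrite onth_drop => el.
  have : onth s2 k by rewrite onthTE (ltn_trans kc) // flaw_size2.
  case ez : onth => [z|//] _.
  have [x' ex' xz] := col_ok_onth (ok_lt kc) ez.
  move: ex'; rewrite ek => -[ex']; rewrite -{}ex' in xz.
  have kl : (k < c.+1 + l)%N by rewrite ltnS (leq_trans (ltnW kc)) // leq_addr.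
  by apply: contraNN (linear_word_onth lw2 kl ez el) => yx; apply: le_trans yx (ltW xz).
- exact: linear_word_sub (take_subseq _ _) lw1.
exact: linear_word_sub (drop_subseq _ _) lw2.
Qed.

(* The only use of (2+1)-freeness: an inversion y < x in the swapped row would
   make u := s1[c] and v := s2[c] comparable to y < x in such a way that u < v,
   so that column c had no flaw. *)
Lemma linear_lower_swap : two_plus_one_free P -> uniq (s1 ++ s2) ->
  linear_word (lower_swap s1 s2 c).
Proof.
move=> free u12; rewrite /linear_word pairwise_cat; apply/and3P; split.
- apply/allrelP => x y /onthP[k]; rewrite onth_take; case: ltnP => // kc ek.
  case/onthP => l; rewrite onth_drop => el.
  (* Freeness restated: every element is comparable to an end of every 2-element chain. *)
  have cmp (a b z : P) : (a < b)%O -> (a >=< z)%O || (b >=< z)%O.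
    by move=> ab; apply/negPn/negP; rewrite negb_or => /andP[az bz]; case: (free a b z).
  have yx_ne : y != x.
    apply/eqP => e; move: u12; rewrite cat_uniq => /and3P[_ /hasPn/(_ x) h _].
    have xs2 : x \in s2 by apply/onthP; exists k.
    by move: (h xs2); rewrite /= -e; case/negP; apply/onthP; exists (c + l)%N.
  apply/negP => le_yx; have yx : (y < x)%O by rewrite lt_neqAle yx_ne.
  have : onth s1 c by rewrite onthTE (leq_ltn_trans (leq_addr l c)) // (onth_size el).
  case eu : onth => [u|//] _.
  have : onth s2 c by rewrite onthTE flaw_size2.
  case ev : onth => [v|//] _.
  have /negP uv : ~~ (u < v)%O by move: flaw_c; rewrite /col_ok eu ev.
  have yu : (y = u) \/ ~~ (y <= u)%O.
    case: (posnP l) => [l0|l0]; [left|right].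
      by move: el; rewrite l0 addn0 eu => -[].
    by apply: (linear_word_onth lw1 _ eu el); rewrite -[X in (X < _)%N]addn0 ltn_add2l.
  have vx : (x = v) \/ ~~ (v <= x)%O.
    move: kc; rewrite ltnS leq_eqVlt => /orP[/eqP kc|kc]; [left|right].
      by move: ek; rewrite kc ev => -[].
    exact: (linear_word_onth lw2 kc ek ev).
  (* Comparing u with the chain y < x gives u < x, since y <= u needs y = u. Then v is compared with
     the chain u < x, and each case yields u < v or the excluded v <= x. *)
  have ux : (u < x)%O.
    case: yu => [<- //|/negP yu].
    have : (u < x)%O \/ (y <= u)%O.
      have /orP[] := cmp _ _ u yx; rewrite /Order.comparable => /orP[].
      + by right.
      + by move=> uy; left; apply: le_lt_trans uy yx.
      + by move=> xu; right; apply: le_trans le_yx xu.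
      + rewrite le_eqVlt => /orP[/eqP ->|]; by [right|left].
    by case.
  case: vx => [xv|/negP vx]; first by rewrite -xv in uv.
  have /orP[] := cmp _ _ v ux; rewrite /Order.comparable => /orP[].
  + rewrite le_eqVlt => /orP[/eqP e|//]; by apply: vx; rewrite -e ltW.
  + by move=> vu; apply: vx; apply: le_trans vu (ltW ux).
  + by move=> xv; apply: uv; apply: lt_le_trans ux xv.
  + by [].
- exact: linear_word_sub (take_subseq _ _) lw2.
exact: linear_word_sub (drop_subseq _ _) lw1.
Qed.

End Swap.

End TailSwap.

(** * The sign-reversing involution *)

Section SignReversingInvolution.

Variables (d : Order.disp_t) (P : finPOrderType d) (N : nat).
Hypothesis free : two_plus_one_free P.

Local Notation word := (#|P|.-bseq P).
Local Notation array := {ffun 'I_N -> word}.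
Local Notation position := ('I_N * 'I_N * 'I_#|P|)%type.
Implicit Types (t : array) (p q : position).

Lemma poset_arrayP t : reflect
  ((forall x, (\sum_i (x \in (t i : seq P)) = 1)%N) /\ forall i, linear_word (t i)) (poset_array t).
Proof.
by apply: (iffP andP) => -[H1 H2]; split; try apply/forallP => x; rewrite ?H1 //;
  [move=> x; apply/eqP/(forallP H1) | exact/forallP].
Qed.

(* A position (r, r', c) is a violation of the column condition in column c,
   between row r and the next row r'. *)
Definition flaw t p : bool :=
  (p.1.2 == p.1.1.+1 :> nat) && ~~ col_ok (t p.1.1) (t p.1.2) p.2.

Definition first_flaw t p : bool :=
  flaw t p && [forall q, flaw t q ==>
    ((p.2 < q.2) || (p.2 == q.2 :> nat) && (q.1.1 <= p.1.1))%N].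

Definition unflawed t : bool := [forall p, ~~ flaw t p].

Lemma first_flaw_exists t : ~~ unflawed t -> exists p, first_flaw t p.
Proof.
case/forallPn => p0; rewrite negbK => f0.
(* As 0 < N - r <= N, this number orders positions by column first and then from the bottom row
   upwards. *)
case: (arg_minnP (fun p : position => p.2 * N + (N - p.1.1))%N f0) => p fp pmin.
exists p; rewrite /first_flaw fp /=; apply/forallP => q; apply/implyP => /pmin.
have := ltn_ord p.1.1; have := ltn_ord q.1.1.
move: (nat_of_ord p.1.1) (nat_of_ord q.1.1) (nat_of_ord p.2) (nat_of_ord q.2) => a b x y.
by case: (ltngtP x y) => //= [yx|->]; nia.
Qed.

Lemma first_flaw_uniq t p q : first_flaw t p -> first_flaw t q -> p = q.
Proof.
case: p q => [[r r'] c] [[s s'] k] /andP[fp /forallP/(_ (s, s', k)) H1].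
case/andP=> fq /forallP/(_ (r, r', c)) H2.
move: H1 H2; rewrite fp fq /=; move: fp fq => /andP[/= /eqP r1 _] /andP[/= /eqP s1 _].
move=> H1 H2; have e1 : c = k by apply: val_inj => /=; lia.
have e2 : r = s by apply: val_inj => /=; lia.
by have e3 : r' = s' by [apply: val_inj; rewrite /= r1 s1 e2]; rewrite e1 e2 e3.
Qed.

Definition swap_tails t p : array := [ffun i =>
  if i == p.1.1 then insub_bseq _ (upper_swap (t p.1.1) (t p.1.2) p.2)
  else if i == p.1.2 then insub_bseq _ (lower_swap (t p.1.1) (t p.1.2) p.2)
  else t i].

(** A repetition-free word has at most [#|P|] letters, so [insub_bseq] does not fall back on its
    default. *)
Lemma insub_bseqK (s : seq P) : uniq s -> insub_bseq #|P| s = s :> seq P.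
Proof.
move=> u; rewrite /insub_bseq /insubd; case: insubP => [? _ -> //|].
by rewrite -(card_uniqP u) max_card.
Qed.

Lemma sum_two_rows (f : 'I_N -> nat) (r r' : 'I_N) : r != r' ->
  (\sum_i f i = f r + f r' + \sum_(i | (i != r) && (i != r')) f i)%N.
Proof.
move=> ne; rewrite (bigD1 r) //= (bigD1 r') ?(eq_sym r') //= addnA; congr (_ + _)%N.
Qed.

Section Swap.

Variables (t : array) (r r' : 'I_N) (c : 'I_#|P|).
Hypotheses (ta : poset_array t) (fp : first_flaw t (r, r', c)).

Let rr' : r' = r.+1 :> nat.
Proof. by case/andP: fp => /andP[/eqP]. Qed.

Let ne_rr' : r != r'.
Proof. by rewrite -val_eqE /= rr' neq_ltn ltnSn. Qed.

Let lw i : linear_word (t i).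
Proof. by case/poset_arrayP: ta. Qed.

Let u12 : uniq (t r ++ t r').
Proof.
rewrite cat_uniq !linear_word_uniq //= andbT; apply/hasPn => x xr'; apply/negP => xr.
have /poset_arrayP[/(_ x)] := ta; rewrite (sum_two_rows _ ne_rr').
by rewrite /= in xr; rewrite xr xr'.
Qed.

Let ok_lt k : (k < c)%N -> col_ok (t r) (t r') k.
Proof.
move=> kc; case/andP: fp => _ /forallP/(_ (r, r', Ordinal (ltn_trans kc (ltn_ord c)))).
rewrite /flaw /= rr' eqxx /=; case: col_ok => //=.
by rewrite ltnNge (ltnW kc) gtn_eqF.
Qed.

Let flaw_c : ~~ col_ok (t r) (t r') c.
Proof. by case/andP: fp => /andP[]. Qed.

Let lwu : linear_word (upper_swap (t r) (t r') c).
Proof. exact: linear_upper_swap. Qed.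

Let lwl : linear_word (lower_swap (t r) (t r') c).
Proof. exact: linear_lower_swap. Qed.

Local Notation t' := (swap_tails t (r, r', c)).

Lemma swap_tails_upper : t' r = upper_swap (t r) (t r') c :> seq P.
Proof. by rewrite ffunE eqxx insub_bseqK // linear_word_uniq. Qed.

Lemma swap_tails_lower : t' r' = lower_swap (t r) (t r') c :> seq P.
Proof. by rewrite ffunE eq_sym (negbTE ne_rr') eqxx insub_bseqK // linear_word_uniq. Qed.

Lemma swap_tails_other i : i != r -> i != r' -> t' i = t i.
Proof. by move=> /negbTE ir /negbTE ir'; rewrite ffunE /= ir ir'. Qed.

Lemma poset_array_swap_tails : poset_array t'.
Proof.
apply/poset_arrayP; split => [x|i].
  have /poset_arrayP[/(_ x) <- _] := ta; rewrite !(sum_two_rows _ ne_rr').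
  congr (_ + _)%N; last by apply: eq_bigr => i /andP[ir ir']; rewrite swap_tails_other.
  have cE s : linear_word s -> nat_of_bool (x \in s) = count_mem x s.
    by move=> ls; rewrite count_uniq_mem // linear_word_uniq.
  rewrite swap_tails_upper swap_tails_lower !cE // -!count_cat.
  by apply/seq.permP; apply: perm_swap.
have [->|ir] := eqVneq i r; first by rewrite swap_tails_upper.
have [->|ir'] := eqVneq i r'; first by rewrite swap_tails_lower.
by rewrite swap_tails_other.
Qed.

Lemma onth_swap_tails_lt i k : (k < c)%N -> onth (t' i) k = onth (t i) k.
Proof.
move=> kc; have [->|ir] := eqVneq i r; first by rewrite swap_tails_upper onth_upper_swap.
have [->|ir'] := eqVneq i r'; first by rewrite swap_tails_lower onth_lower_swap // ltnW.
by rewrite swap_tails_other.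
Qed.

Lemma onth_swap_tails_c i : i != r -> onth (t' i) c = onth (t i) c.
Proof.
move=> ir; have [->|ir'] := eqVneq i r'; first by rewrite swap_tails_lower onth_lower_swap.
by rewrite swap_tails_other.
Qed.

(** Columns left of c are unchanged, and in column c only row r changes. Row pairs below r therefore
    keep their status there, which is why the lowest flaw is chosen. *)
Lemma first_flaw_swap_tails : first_flaw t' (r, r', c).
Proof.
rewrite /first_flaw {1}/flaw /= rr' eqxx /= swap_tails_upper swap_tails_lower flaw_swap //=.
apply/forallP => -[[s s'] k]; apply/implyP => /=.
have /forallP/(_ (s, s', k)) := proj2 (andP fp); rewrite /flaw /=.
case: (ltngtP c k) => //= [kc|/val_inj <-] H.
  by move: H; rewrite /col_ok !onth_swap_tails_lt //; case: (_ && _).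
case: (leqP s r) => //= rs; move: H; rewrite leqNgt rs /= implybF.
have [/eqP s1|//] := boolP (_ == _ :> nat).
rewrite /col_ok !onth_swap_tails_c //= => [/negPn ->//||].
  by rewrite -val_eqE /=; lia.
by rewrite -val_eqE /=; lia.
Qed.

Lemma swap_tailsK : swap_tails t' (r, r', c) = t.
Proof.
apply/ffunP => i; rewrite ffunE; apply: val_inj => /=.
have [->|ir] := eqVneq i r.
  rewrite swap_tails_upper swap_tails_lower upper_swapK //.
  by rewrite insub_bseqK // linear_word_uniq.
have [->|ir'] := eqVneq i r'; last by rewrite swap_tails_other.
rewrite swap_tails_upper swap_tails_lower lower_swapK //.
by rewrite insub_bseqK // linear_word_uniq.
Qed.

Lemma size_swap_tails_upper : (size (t' r)).+1 = size (t r').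
Proof. by rewrite swap_tails_upper size_upper_swap. Qed.

Lemma size_swap_tails_lower : size (t' r') = (size (t r)).+1.
Proof. by rewrite swap_tails_lower size_lower_swap. Qed.

End Swap.

Variable la : nat -> nat.

(* Row i has length la_(s i) - s i + i, as in the s-th term of the expansion of
   a Jacobi-Trudi determinant. *)
Definition twisted_shape (s : 'S_N) t : bool :=
  [forall i, (size (t i) + s i == la (s i) + i)%N].

Definition swap_pair (st : 'S_N * array) : 'S_N * array :=
  if [pick p | first_flaw st.2 p] is Some p
  then ((tperm p.1.1 p.1.2 * st.1)%g, swap_tails st.2 p) else st.

Lemma swap_pairE (s : 'S_N) t p : first_flaw t p ->
  swap_pair (s, t) = ((tperm p.1.1 p.1.2 * s)%g, swap_tails t p).
Proof.
move=> fp; rewrite /swap_pair /=; case: pickP => [q fq|/(_ p)]; last by rewrite fp.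
by rewrite (first_flaw_uniq fp fq).
Qed.

(** The two lengths are exchanged with a shift by one, which the difference of the row indices r and
    r + 1 absorbs. *)
Lemma twisted_shape_swap (s : 'S_N) t p : poset_array t -> first_flaw t p ->
  twisted_shape s t -> twisted_shape (tperm p.1.1 p.1.2 * s)%g (swap_tails t p).
Proof.
case: p => [[r r'] c] ta fp /forallP sh; apply/forallP => i /=; rewrite permM.
have rr' : r' = r.+1 :> nat by case/andP: fp => /andP[/eqP].
have /eqP hr := sh r; have /eqP hr' := sh r'.
have su := size_swap_tails_upper ta fp; have sl := size_swap_tails_lower ta fp.
case: tpermP => [->|->|/eqP ir /eqP ir'].
- by move: hr'; rewrite -su rr' addSn addnS => -[->].
- by rewrite sl rr' addSn addnS hr.
by rewrite swap_tails_other.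
Qed.

Definition admissible (st : 'S_N * array) : bool :=
  poset_array st.2 && twisted_shape st.1 st.2.

(** [swap_pair] is an involution on the flawed admissible pairs and composes the permutation with a
    transposition, so reindexing by it negates each term. *)
Lemma sum_flawed (R : pzRingType) :
  let S := \sum_(st | admissible st && ~~ unflawed st.2) (-1) ^+ st.1 : R in S = - S.
Proof.
move=> S; rewrite {1}/S.
have flip st : admissible st && ~~ unflawed st.2 ->
    [/\ admissible (swap_pair st) && ~~ unflawed (swap_pair st).2,
      swap_pair (swap_pair st) = st & (swap_pair st).1 = ~~ odd_perm st.1 :> bool].
  case: st => s t /andP[/andP[/= ta sh] nf]; have [p fp] := first_flaw_exists nf.
  rewrite (swap_pairE _ fp) /admissible /= (twisted_shape_swap ta fp sh) andbT.
  case: p fp => [[r r'] c] fp; have f' := first_flaw_swap_tails ta fp.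
  rewrite poset_array_swap_tails //= (swap_pairE _ f') /= swap_tailsK // mulgA tperm2 mul1g.
  rewrite odd_permM odd_tperm; have rr' : r' = r.+1 :> nat by case/andP: fp => /andP[/eqP].
  have -> : r != r' by rewrite -val_eqE /=; lia.
  by split => //; apply/forallPn; exists (r, r', c); case/andP: f' => ->.
rewrite (reindex_onto swap_pair swap_pair) => [|st /flip[]//].
rewrite -sumrN; apply: eq_big => [st|st /andP[H /eqP e]].
  apply/andP/idP => [[/flip[H _ _] /eqP e]|/flip[H e _]]; first by rewrite e in H.
  by rewrite H e eqxx.
by have [_ _] := flip _ H; rewrite e => ->; rewrite signrN opprK.
Qed.

End SignReversingInvolution.

(** * The coefficient of x^(la + delta) in a_delta L_P *)

Section Coefficient.

Variables (d : Order.disp_t) (P : finPOrderType d) (N : nat).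
Hypothesis free : two_plus_one_free P.

Local Notation word := (#|P|.-bseq P).
Local Notation array := {ffun 'I_N -> word}.

(** Flaws are only recorded in columns below [#|P|]; beyond them all rows have ended. *)
Lemma unflawed_col_ok (t : array) (i j : 'I_N) k : unflawed t -> j = i.+1 :> nat ->
  col_ok (t i) (t j) k.
Proof.
move=> /forallP uf ij; case: (ltnP k #|P|) => [kP|Pk].
  by have := uf (i, j, Ordinal kP); rewrite /flaw /= ij eqxx /= negbK.
by rewrite /col_ok onth_default // (leq_trans (size_bseq _)).
Qed.

Lemma unflawed_size (t : array) (i j : 'I_N) : unflawed t -> (i <= j)%N ->
  (size (t j) <= size (t i))%N.
Proof.
move=> uf; have step (i' j' : 'I_N) : j' = i'.+1 :> nat -> (size (t j') <= size (t i'))%N.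
  (* In the column just past the end of the upper row, a longer lower row would have an entry with
     nothing above it. *)
  move=> e; rewrite leqNgt; apply/negP => lt.
  have := unflawed_col_ok (size (t i')) uf e; rewrite /col_ok.
  by move: lt; rewrite -onthTE; case: onth => // x _; rewrite onth_default.
move: {-1}(j - i)%N (erefl (j - i)%N) => k; elim: k j => [|k IH] j e ij.
  by have -> : j = i by apply: val_inj => /=; lia.
have lt : (j.-1 < N)%N by have := ltn_ord j; lia.
apply: (@leq_trans (size (t (Ordinal lt)))); first by apply: step => /=; lia.
by apply: IH => /=; lia.
Qed.

Section Shape.

Variable la : nat -> nat.
Hypothesis la_le : forall i j, (i <= j)%N -> (la j <= la i)%N.

Definition shaped_array (t : array) : bool :=
  [&& poset_array t, unflawed t & [forall i : 'I_N, size (t i) == la i]].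

Lemma twisted_shape1 (t : array) : twisted_shape la 1%g t = [forall i : 'I_N, size (t i) == la i].
Proof. by apply: eq_forallb => i; rewrite perm1 eqn_add2r. Qed.

(** The row sizes plus delta are strictly decreasing and rearrange la + delta by [s], which is
    strictly decreasing too. *)
Lemma unflawed_twist (s : 'S_N) (t : array) : unflawed t -> twisted_shape la s t -> s = 1%g.
Proof.
move=> uf /forallP sh.
apply: (@decreasing_exp_perm1 N (fun i => size (t i) + (N - i.+1))%N (delta_shift la)).
- by move=> i j ij; have := unflawed_size uf (ltnW ij); have := ltn_ord j; lia.
- by move=> i j ij; rewrite /delta_shift; have := la_le (ltnW ij); have := ltn_ord j; lia.
move=> i; rewrite /delta_shift; have /eqP := sh i.
have := ltn_ord i; have := ltn_ord (s i); lia.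
Qed.

Lemma sum_unflawed (R : pzRingType) :
  \sum_(st : 'S_N * array | admissible la st && unflawed st.2) (-1) ^+ st.1 =
  #|[set t | shaped_array t]|%:R :> R.
Proof.
rewrite (eq_bigl (fun st : 'S_N * array => (st.1 == 1%g) && shaped_array st.2)); last first.
  move=> [s t]; rewrite /admissible /shaped_array /=.
  have [->|s1] := eqVneq s 1%g; first by rewrite twisted_shape1 andbAC -andbA.
  apply/negP => /andP[/andP[_ sh] uf]; case/eqP: s1; exact: unflawed_twist sh.
rewrite -(pair_big (fun s => s == 1%g) shaped_array (fun s _ => (-1) ^+ odd_perm s)) /=.
rewrite big_pred1_eq odd_perm1 expr0 sumr_const; congr (_ *+ _).
by apply: eq_card => t; rewrite inE.
Qed.

Variable F : fieldType.
Hypothesis charF : [pchar F] =i pred0.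

Lemma sum_admissible : \sum_(st : 'S_N * array | admissible la st) (-1) ^+ st.1 =
  #|[set t | shaped_array t]|%:R :> F.
Proof.
rewrite (bigID (fun st : 'S_N * array => unflawed st.2)) /= sum_unflawed.
set S := \sum_(st | _) _; have e : S = - S := sum_flawed N free la F.
have /eqP : 2%:R * S = 0 by rewrite mulr_natl mulr2n {1}e addNr.
by rewrite mulf_eq0; move/pcharf0P: charF => -> /= /eqP->; rewrite addr0.
Qed.

Lemma mcoeff_linear_function :
  (alternant F (delta_shift (fun=> 0%N)) * linear_function F P N)
    @_[multinom delta_shift la i | i < N] = #|[set t | shaped_array t]|%:R.
Proof.
rewrite -sum_admissible linear_function_arrays alternantE mulr_suml raddf_sum /=.
rewrite -(pair_big_dep xpredT (fun s t => admissible la (s, t)) (fun s _ => (-1) ^+ odd_perm s)) /=.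
apply: eq_bigr => s _; rewrite mulr_sumr raddf_sum /=.
(* Permuting the rows by [s] turns the condition sizes + s(delta) = la + delta into
   [twisted_shape]. *)
pose h (u : 'S_N) (t : array) : array := [ffun i => t (u i)].
have hK : cancel (h s^-1%g) (h s) by move=> t; apply/ffunP => i; rewrite !ffunE permK.
rewrite (reindex_inj (can_inj hK)) [LHS]big_mkcond [RHS]big_mkcond.
apply: eq_bigr => t _; rewrite /admissible /=.
have -> : poset_array (h s^-1%g t) = poset_array t.
  rewrite /poset_array; congr (_ && _).
    apply: eq_forallb => x; congr (_ == _); rewrite [RHS](reindex_inj (@perm_inj _ s^-1%g)).
    by apply: eq_bigr => i _; rewrite ffunE.
  apply/forallP/forallP => H i; last by rewrite ffunE.
  by have := H (s i); rewrite ffunE permK.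
case: (poset_array t) => //=.
rewrite -scalerAl mcoeffZ -mpolyXD mcoeffX.
set b := (_ == _); set b' := twisted_shape _ _ _.
suff -> : b = b' by case: b'; rewrite ?mulr1 ?mulr0.
apply/eqP/forallP => [/mnmP H i|H].
  have := H (s i); rewrite mnmDE !mnmE ffunE permK /delta_shift => e.
  apply/eqP; have := ltn_ord i; have := ltn_ord (s i); lia.
apply/mnmP => i; rewrite mnmDE !mnmE ffunE /delta_shift.
have := H (s^-1%g i); rewrite permKV => /eqP.
have := ltn_ord i; have := ltn_ord (s^-1%g i); lia.
Qed.

End Shape.

(** * Tableaux as unflawed arrays *)

Section TableauxArrays.

Variable la : intpart.
Hypothesis le_size : (size (parts la) <= N)%N.

Local Notation ell := (size (parts la)).
Local Notation row_length i := (nth 0%N (parts la) i).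
Local Notation Cell j := (Tagged (fun i : 'I_ell => 'I_(row_length i)) j).
Local Notation widen := (widen_ord le_size).

(** A relation rather than a function, since the rows of an arbitrary filling may exceed the length
    bound of [word]. *)
Definition rows_of (a : {ffun cell la -> P}) (t : array) : Prop :=
  (forall i : 'I_ell, t (widen i) = row_word a i :> seq P) /\
  (forall i : 'I_N, (ell <= i)%N -> t i = [::] :> seq P).

Lemma size_row_word (a : {ffun cell la -> P}) i : size (row_word a i) = row_length i.
Proof. by rewrite size_map size_enum_ord. Qed.

Lemma onth_row_word (a : {ffun cell la -> P}) (i : 'I_ell) (j : 'I_(row_length i)) :
  onth (row_word a i) j = Some (a (Cell j)).
Proof.
by rewrite onth_map onthE (nth_map j) ?size_enum_ord // nth_ord_enum.
Qed.

Lemma widenP (i : 'I_N) : (i < ell)%N -> exists i' : 'I_ell, i = widen i'.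
Proof. by move=> h; exists (Ordinal h); apply: val_inj. Qed.

Lemma rows_of_size a t : rows_of a t -> forall i : 'I_N, size (t i) = row_length i.
Proof.
move=> [t1 t2] i; case: (ltnP i ell) => [/widenP[i' ->]|h].
  by rewrite t1 size_row_word.
by rewrite t2 // nth_default.
Qed.

Lemma rows_of_big (R : Type) (idx : R) (op : Monoid.com_law idx) a t (G : seq P -> R) :
  rows_of a t -> G [::] = idx ->
  \big[op/idx]_i G (t i) = \big[op/idx]_i G (row_word a i).
Proof.
move=> [t1 t2] G0; rewrite (bigID (fun i : 'I_N => (i < ell)%N)) /= [X in op _ X]big1 => [|i]; last first.
  by rewrite -leqNgt => h; rewrite t2.
rewrite Monoid.mulm1 (big_ord_narrow le_size) /=.
by apply: eq_bigr => i _; rewrite t1.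
Qed.

Lemma P_tableau_rows a t : rows_of a t -> P_tableau a = poset_array t && unflawed t.
Proof.
move=> at_; have [t1 t2] := at_.
have linE : [forall i, linear_extension [set x in row_word a i] (row_word a i)] =
            [forall i, linear_word (t i)].
  apply/forallP/forallP => H i; last by rewrite linear_extensionE eqxx -t1 H.
  case: (ltnP i ell) => [/widenP[i' ->]|h]; last by rewrite t2.
  by rewrite t1; have := H i'; rewrite linear_extensionE => /andP[].
have [lw|nlw] := boolP [forall i, linear_word (t i)]; last first.
  by rewrite /P_tableau /poset_array linE (negbTE nlw) /= !andbF.
rewrite /P_tableau /poset_array linE lw /= andbT; congr (_ && _).
  apply: eq_forallb => x; congr (_ == _).
  rewrite (@rows_of_big _ _ _ a t (fun s => nat_of_bool (x \in s)) at_) //.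
  (* The cells containing x are counted row by row; a repetition-free row has at most one. *)
  transitivity (\sum_(i < ell) \sum_(j < row_length i) (a (Cell j) == x))%N.
    rewrite sig_big_dep -sum1dep_card big_mkcond /=.
    by apply: eq_bigr => -[i j] _; case: (_ == x).
  apply: eq_bigr => i _.
  rewrite -(count_uniq_mem x); last by rewrite -t1; exact: linear_word_uniq (forallP lw _).
  rewrite count_map -sum1_count big_enum_cond [RHS]big_mkcond /=.
  by apply: eq_bigr => j _; case: (_ == x).
apply/forallP/forallP => [H [[r r'] c]|uf [i j]].
  rewrite /flaw /=; apply/negP => /andP[/eqP rr'] /negP; apply.
  case: (ltnP c (size (t r'))) => cr'; last by rewrite /col_ok onth_default.
  have r'l : (r' < ell)%N.
    by rewrite -nth_parts_gt0 -(rows_of_size at_); apply: leq_ltn_trans cr'.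
  have [s' es'] := widenP r'l.
  have [s es] : exists s, r = widen s by apply: widenP; lia.
  have ss' : s' = s.+1 :> nat by move: rr'; rewrite es es'.
  have c' : (c < row_length s')%N by move: cr'; rewrite (rows_of_size at_) es'.
  (* The cell above exists because the parts decrease weakly. *)
  have c1 : (c < row_length s)%N.
    by apply: leq_trans c' _; apply: nth_parts_le; rewrite ss'.
  have lt : (a (Cell (Ordinal c1)) < a (Cell (Ordinal c')))%O.
    apply: (implyP (forallP (H _) _)).
    by rewrite /cell_row /cell_col /=; apply/andP; split; apply/eqP.
  have o1 := onth_row_word a (Ordinal c1); have o2 := onth_row_word a (Ordinal c').
  by rewrite /col_ok es es' !t1 o1 o2.
apply/forallP => -[i' j']; apply/implyP => /andP[/eqP ii' /eqP jj'].
rewrite /cell_row /cell_col /= in ii' jj'.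
have /forallP uf' : unflawed t by apply/forallP.
have := @unflawed_col_ok t (widen i) (widen i') j (introT forallP uf) ii'.
have o1 := onth_row_word a j; have o2 := onth_row_word a j'.
by rewrite /col_ok !t1 -[X in onth (row_word a i') X]jj' o1 o2.
Qed.

Definition array_of (a : {ffun cell la -> P}) : array := [ffun i : 'I_N => insub_bseq _
  (if insub (i : nat) is Some i' then row_word a (i' : 'I_ell) else [::])].

Lemma rows_of_array a : P_tableau a -> rows_of a (array_of a).
Proof.
case/and3P => _ /forallP lin _.
split => i; rewrite ffunE.
  rewrite insubT //= => h; rewrite (_ : Sub _ _ = i); last exact: val_inj.
  rewrite insub_bseqK //.
  by have := lin i; rewrite linear_extensionE => /andP[_ /linear_word_uniq].
by move=> h; rewrite insubF ?insub_bseqK // ltnNge h.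
Qed.

Lemma map_tnth_cast n (s : seq P) (e : n = size s) :
  [seq tnth (in_tuple s) (cast_ord e j) | j <- enum 'I_n] = s.
Proof.
subst n; rewrite -[RHS](map_tnth_enum (in_tuple s)).
by apply: eq_map => j; rewrite cast_ord_id.
Qed.

Lemma exists_tableau (t : array) : (forall i : 'I_N, size (t i) = row_length i) ->
  exists a, rows_of a t.
Proof.
move=> sz; have e (i : 'I_ell) : row_length i = size (t (widen i)) by rewrite sz.
exists [ffun c : cell la => tnth (in_tuple (t (widen (tag c)))) (cast_ord (e (tag c)) (tagged c))].
split => i; last by move=> h; apply/nilP; rewrite /nilp sz nth_default.
rewrite -[LHS](map_tnth_cast (e i)); apply: eq_map => j.
by rewrite ffunE.
Qed.

Lemma rows_of_inj a b t : rows_of a t -> rows_of b t -> a = b.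
Proof.
move=> [ta _] [tb _]; apply/ffunP => -[i j].
have := onth_row_word a j; rewrite -ta tb onth_row_word => -[<-].
by [].
Qed.

Lemma rows_of_fun a t u : rows_of a t -> rows_of a u -> t = u.
Proof.
move=> [t1 t2] [u1 u2]; apply/ffunP => i; apply: val_inj => /=.
case: (ltnP i ell) => [/widenP[i' ->]|h]; first by rewrite t1 u1.
by rewrite t2 ?u2.
Qed.

Lemma card_tableaux :
  #|[set a : {ffun cell la -> P} | P_tableau a]| =
  #|[set t | shaped_array (nth 0%N (parts la)) t]|.
Proof.
rewrite -(@card_in_imset _ _ array_of) => [|a b]; last first.
  rewrite !inE => /rows_of_array ra /rows_of_array rb e.
  by rewrite e in ra; apply: rows_of_inj ra rb.
apply: eq_card => t; rewrite !inE; apply/imsetP/and3P => [[a + ->]|[pt uf /forallP sz]].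
  rewrite inE => ta; have ra := rows_of_array ta.
  move: ta; rewrite (P_tableau_rows ra) => /andP[-> ->]; split => //.
  by apply/forallP => i; rewrite (rows_of_size ra).
have [a ra] := @exists_tableau t (fun i => eqP (sz i)).
have ta : P_tableau a by rewrite (P_tableau_rows ra) pt.
by exists a; rewrite ?inE //; apply: rows_of_fun ra (rows_of_array ta).
Qed.

End TableauxArrays.

End Coefficient.

(** * Finiteness of the set of shapes with tableaux *)

Section TableauSupport.

Variables (d : Order.disp_t) (P : finPOrderType d) (la : intpart).

Lemma P_tableau_inj (a : {ffun cell la -> P}) : P_tableau a -> injective a.
Proof.
case/and3P => /forallP one _ _ c c' e; have /cards1P[b eb] := one (a c').
have : c \in [set b] by rewrite -eb inE e.
have : c' \in [set b] by rewrite -eb inE.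
by rewrite !inE => /eqP-> /eqP->.
Qed.

Lemma P_tableau_size (a : {ffun cell la -> P}) : P_tableau a ->
  (size (parts la) <= #|P|)%N /\ forall i, (nth 0%N (parts la) i <= #|P|)%N.
Proof.
move=> /P_tableau_inj inj; pose T (i : 'I_(size (parts la))) := 'I_(nth 0%N (parts la) i).
split=> [|i].
  have gt0 (i : 'I_(size (parts la))) : (0 < nth 0%N (parts la) i)%N by rewrite nth_parts_gt0.
  rewrite -[X in (X <= _)%N]card_ord.
  (* The first column injects into [P]; below, row i does. *)
  apply: (@leq_card _ _ (fun i => a (existT T i (Ordinal (gt0 i))))) => i j /inj e.
  by have := congr1 (@tag _ _) e.
case: (ltnP i (size (parts la))) => [lt|h]; last by rewrite nth_default.
rewrite -[X in (X <= _)%N]card_ord.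
apply: (@leq_card _ _ (fun j => a (existT T (Ordinal lt) j))) => j k /inj /eqP.
by rewrite -tag_eqE /tag_eq /= eqxx tagged_asE => /eqP.
Qed.

End TableauSupport.

(** Such partitions are words of length at most n over {0, ..., n}; this provides the finite support
    of the coefficient function. *)
Lemma bounded_partitions n : exists S : {fset intpart}, forall mu : intpart,
  (size (parts mu) <= n)%N -> (forall i, (nth 0%N (parts mu) i <= n)%N) -> mu \in S.
Proof.
pose s := [seq [seq val j | j <- b] | b : n.-bseq 'I_n.+1].
exists [fset mu in (pmap insub s : seq intpart)]%fset => mu sz le.
rewrite in_fset /= mem_pmap_sub; apply/imageP.
have sb : (size [seq inord j : 'I_n.+1 | j <- parts mu] <= n)%N by rewrite size_map.
exists (Bseq sb) => //=; rewrite -map_comp; apply/esym/map_id_in => j /(nthP 0%N)[i _ <-].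
by rewrite /= inordK ?ltnS.
Qed.

Theorem theorem4p20 (F : fieldType) (charF : [pchar F] =i pred0)
    (d : Order.disp_t) (P : finPOrderType d) (Pfree : two_plus_one_free P)
    (n : nat) (cardP : #|P| = n)
    (lam : intpart) (lam_n : sumn (parts lam) = n) :
  schur_coefficient (linear_function F P) lam
    (#|[set a : {ffun cell lam -> P} | P_tableau a]|%:R).
Proof.
have [S HS] := bounded_partitions #|P|.
pose T mu : F := #|[set a : {ffun cell mu -> P} | P_tableau a]|%:R.
pose c : {fsfun intpart -> F with 0} := [fsfun mu in S => T mu | 0].
(* Outside [S] there are no tableaux, so the default value 0 is the correct count. *)
have cE mu : c mu = T mu.
  rewrite fsfunE; case: ifP => // /negP muS; rewrite /T.
  case: (set_0Vmem [set a : {ffun cell mu -> P} | P_tableau a]) => [->|[a]].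
    by rewrite cards0.
  by rewrite inE => /P_tableau_size[sz le]; case: muS; apply: HS.
rewrite -[_%:R]/(T lam) -cE; apply: schur_coefficientP => // [N s|N mu smu].
  exact: msym_linear_function.
rewrite mcoeff_linear_function // ?cE /T ?(card_tableaux _ smu) // => i j.
exact: nth_parts_le.
Qed.
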